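(* Let $M$ be a compact, orientable smooth manifold of dimension $m$ (possibly with boundary) and let $n\ge m$ be such that there exists at least one full-ranked $\mathbb R^n$-valued one-form on $M$, i.e. $\Omega^1_+(M,\mathbb R^n)\neq\emptyset$. Then the mapping $$\tilde\pi:\Omega^1_+(M,\mathbb R^n)\to\operatorname{Met}(M),\qquad \alpha\mapsto\alpha^T\alpha,$$ is a Riemannian submersion, where $\Omega^1_+(M,\mathbb R^n)$ is equipped with the generalized Ebin metric $G$ and $\operatorname{Met}(M)$ carries the multiple of the Ebin metric $$(h,k)_g=\frac14\int_M\operatorname{tr}\big(hg^{-1}kg^{-1}\big)\,\mu_g .$$
   Context: $\Omega^1_+(M,\mathbb R^n)$ is the open subset of the Fréchet space $\Omega^1(M,\mathbb R^n)$ of smooth $\mathbb R^n$-valued one-forms consisting of those $\alpha$ for which $\alpha(x):T_xM\to\mathbb R^n$ is injective for all $x\in M$. $\operatorname{Met}(M)$ is the space of smooth Riemannian metrics on $M$, an open subset of the space $\Gamma(S^2T^*M)$ of smooth symmetric $(0,2)$-tensor fields, so $T_g\operatorname{Met}(M)=\Gamma(S^2T^*M)$. For a full-ranked one-form $\alpha$, $\alpha^T\alpha$ denotes the Riemannian metric on $M$ which at $x$ is the pullback of the Euclidean scalar product of $\mathbb R^n$ under $\alpha(x)$. In local coordinates (one-forms represented at $x$ by $n\times m$ matrices) $$G_\alpha(\zeta,\eta)=\int_M \operatorname{tr}\big(\zeta_x(\alpha_x^T\alpha_x)^{-1}\eta_x^T\big)\sqrt{\det(\alpha_x^T\alpha_x)}\,dx,\qquad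 \zeta,\eta\in\Omega^1(M,\mathbb R^n).$$ In the metric on $\operatorname{Met}(M)$, $g,h,k$ are represented at each $x$ by symmetric $m\times m$ matrices with respect to an arbitrary basis of $T_xM$, and $\mu_g$ is the volume form of $g$. A Riemannian submersion is a surjective submersion whose differential at each point restricts to an isometry from the orthogonal complement of its kernel onto the tangent space of the target. *)

(* Defs.v *)
From HB Require Import structures.
From mathcomp Require Import all_boot all_order all_algebra.
From mathcomp Require Import all_classical all_reals all_analysis.

Set Implicit Arguments.
Unset Strict Implicit.
Unset Printing Implicit Defensive.

Import Order.TTheory GRing.Theory Num.Theory.
Import numFieldNormedType.Exports.

Local Open Scope classical_set_scope.
Local Open Scope ring_scope.

Section HalfSpace.
Context {R : realType} {m : nat}.
Implicit Types (y : 'cV[R]_m) (k : 'I_m) (V : set 'cV[R]_m).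

(* [0, +oo[ * R^(m-1); it is the whole space for m = 0. *)
Definition halfspace : set 'cV[R]_m :=
  [set y | forall k, k = 0%N :> nat -> 0 <= y k 0].

Definition relatively_open V :=
  exists2 U : set 'cV[R]_m, open U & V = U `&` halfspace.

(* The increments t -> 0, t != 0, along the k-th axis that do not leave the
   half-space: two-sided at interior points, one-sided in the direction normal
   to the boundary at boundary points. *)
Definition increments k y : set_system R :=
  within [set t | halfspace (y + t *: delta_mx k 0)] (0 : R)^'.

Definition diff_quotient {W : lmodType R} k (f : 'cV[R]_m -> W) y (t : R) : W :=
  t^-1 *: (f (y + t *: delta_mx k 0) - f y).

Definition pderiv {W : normedModType R} k (f : 'cV[R]_m -> W) y : W :=
  lim (diff_quotient k f y @ increments k y).

Definition pderivs {W : normedModType R} (w : seq 'I_m) (f : 'cV[R]_m -> W) :=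
  foldr pderiv f w.

(* Smoothness up to the boundary. For V relatively open this amounts, by
   Seeley's extension theorem, to f being locally the restriction of a C^oo
   function defined on an open subset of R^m. *)
Definition smooth_on {W : normedModType R} V (f : 'cV[R]_m -> W) :=
  forall w : seq 'I_m, {within V, continuous (pderivs w f)} /\
    forall k y, V y -> cvg (diff_quotient k (pderivs w f) y @ increments k y).

Definition jacobian {n} (f : 'cV[R]_m -> 'cV[R]_n) y : 'M[R]_(n, m) :=
  \matrix_(i, k) pderiv k f y i 0.

End HalfSpace.

Section SmoothTheory.
Context {R : realType} {m : nat}.
Implicit Types (y : 'cV[R]_m) (k : 'I_m).

Lemma increments_proper k y : halfspace y -> ProperFilter (increments k y).
Proof.
move=> Hy; apply: Build_ProperFilter_ex => A; rewrite /increments /within /=.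
move=> [e /= e0 he].
have e20 : 0 < e / 2 by rewrite divr_gt0.
exists (e / 2); apply: (he (e / 2)) => /=.
- rewrite /ball_ /= sub0r normrN gtr0_norm//.
  by rewrite ltr_pdivrMr// ltr_pMr// ltr1n.
- by rewrite gt_eqF.
- move=> j j0; rewrite !mxE addr_ge0 ?Hy// mulr_ge0//; exact: ltW.
Qed.

Lemma increments_near (V : set 'cV[R]_m) k y : relatively_open V -> V y ->
  \forall t \near increments k y, V (y + t *: delta_mx k 0).
Proof.
move=> [U oU VE]; rewrite VE => -[Uy Hy].
have h : \forall t \near (0 : R), U (y + t *: delta_mx k 0).
  have cf : {for (0 : R), continuous (fun t : R => y + t *: (delta_mx k 0 : 'cV[R]_m))}.
    apply: cvgD; first exact: cvg_cst.
    by apply: cvgZr_tmp; exact: cvg_id.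
  apply: cf => /=; rewrite scale0r addr0.
  exact: open_nbhs_nbhs.
rewrite /increments /within /prop_near1 /nbhs /=.
by apply: (@nbhs_dnbhs _ (0 : R)); apply: filterS h => t Ut Ht; split.
Qed.

Section W.
Context {W : normedModType R} (V : set 'cV[R]_m) (oV : relatively_open V).
Implicit Types (f g : 'cV[R]_m -> W).

Let VH y : V y -> halfspace y.
Proof. by case: oV => U _ -> []. Qed.

Lemma diff_quotient_eq_near f g k y : (forall z, V z -> f z = g z) -> V y ->
  \forall t \near increments k y, diff_quotient k f y t = diff_quotient k g y t.
Proof.
move=> fg Vy; apply: filterS (increments_near k oV Vy) => t Vt.
by rewrite /diff_quotient !fg.
Qed.

Lemma diff_quotient_eq_cvg f g k y (l : W) : (forall z, V z -> f z = g z) ->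
  V y -> diff_quotient k f y @ increments k y --> l ->
  diff_quotient k g y @ increments k y --> l.
Proof.
move=> fg Vy; have := diff_quotient_eq_near k fg Vy.
by move=> /near_eq_cvg h; apply: cvg_trans.
Qed.

Lemma pderiv_cvg f k y (l : W) : V y ->
  diff_quotient k f y @ increments k y --> l -> pderiv k f y = l.
Proof.
move=> Vy fl; have ? := increments_proper k (VH Vy).
exact: (cvg_lim (@norm_hausdorff _ W) fl).
Qed.

Lemma smooth_on_coind (P : ('cV[R]_m -> W) -> Prop) :
  (forall f, P f -> {within V, continuous f} /\
     forall k, exists2 g, P g & forall y, V y ->
       diff_quotient k f y @ increments k y --> g y) ->
  forall f, P f -> smooth_on V f.
Proof.
move=> HP f Pf w.
have [g Pg eg] : exists2 g, P g & forall y, V y -> pderivs w f y = g y.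
  elim: w => [|k w [g Pg eg]]; first by exists f.
  have [_ /(_ k)[h Ph hl]] := HP _ Pg.
  exists h => // y Vy /=; apply: pderiv_cvg => //.
  by apply: diff_quotient_eq_cvg (hl y Vy) => // z Vz; rewrite eg.
have [cg dg] := HP _ Pg; split.
  apply/subspace_continuousP => y Vy; rewrite /from_subspace (eg y Vy).
  have := (subspace_continuousP _ _).1 cg y Vy; rewrite /from_subspace; apply: cvg_trans.
  apply: near_eq_cvg; apply: (@filterE _ (nbhs y)) => z Vz.
  by rewrite /from_subspace eg.
move=> k y Vy; have [h _ /(_ y Vy) hl] := dg k; apply/cvg_ex; exists (h y).
by apply: diff_quotient_eq_cvg hl => // z Vz; rewrite eg.
Qed.

Lemma smooth_on_continuous f : smooth_on V f -> {within V, continuous f}.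
Proof. by move=> /(_ [::])[]. Qed.

Lemma smooth_on_pderiv f k : smooth_on V f -> smooth_on V (pderiv k f).
Proof. by move=> sf w; have := sf (rcons w k); rewrite /pderivs foldr_rcons. Qed.

Lemma smooth_on_cvg f k y : smooth_on V f -> V y ->
  diff_quotient k f y @ increments k y --> pderiv k f y.
Proof. by move=> /(_ [::])[_ /(_ k y)] h /h. Qed.

Lemma smooth_onD f g : smooth_on V f -> smooth_on V g -> smooth_on V (f \+ g).
Proof.
move=> sf sg.
apply: (@smooth_on_coind (fun h =>
  exists f g, [/\ smooth_on V f, smooth_on V g & h = f \+ g])); last first.
  by exists f, g.
move=> {sf sg}_ [{}f [{}g [sf sg ->]]]; split.
  by move=> x; apply: cvgD; exact: smooth_on_continuous.
move=> k; exists (pderiv k f \+ pderiv k g).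
  by exists (pderiv k f), (pderiv k g); split => //; exact: smooth_on_pderiv.
move=> y Vy; rewrite (_ : diff_quotient k (f \+ g) y =
  diff_quotient k f y \+ diff_quotient k g y); last first.
  by apply/funext => t; rewrite /diff_quotient /= -scalerDr opprD addrACA.
by have ? := increments_proper k (VH Vy); apply: cvgD; exact: smooth_on_cvg.
Qed.

Lemma smooth_onZ (a : R) f : smooth_on V f -> smooth_on V (a \*: f).
Proof.
move=> sf.
apply: (@smooth_on_coind (fun h =>
  exists f, smooth_on V f /\ h = a \*: f)); last by exists f.
move=> {sf}_ [{}f [sf ->]]; split.
  by move=> x; apply: cvgZl_tmp; exact: smooth_on_continuous.
move=> k; exists (a \*: pderiv k f).
  by exists (pderiv k f); split => //; exact: smooth_on_pderiv.
move=> y Vy; rewrite (_ : diff_quotient k (a \*: f) y =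
  a \*: diff_quotient k f y); last first.
  apply/funext => t; rewrite /diff_quotient /= -scalerBr !scalerA.
  by rewrite mulrC.
by have ? := increments_proper k (VH Vy); apply: cvgZl_tmp; exact: smooth_on_cvg.
Qed.

Lemma smooth_on0 : smooth_on V (fun=> 0 : W).
Proof.
apply: (@smooth_on_coind (fun h => h = fun=> 0)) => // _ ->; split.
  by move=> x; exact: cvg_cst.
move=> k; exists (fun=> 0) => // y Vy.
rewrite (_ : diff_quotient _ _ _ = fun=> 0); last first.
  by apply/funext => t; rewrite /diff_quotient subrr scaler0.
by have ? := increments_proper k (VH Vy); exact: cvg_cst.
Qed.

End W.

Lemma cvg_mulTmx {T : Type} {F : set_system T} {FF : Filter F} {p q r : nat}
    (f : T -> 'M[R]_(p, q)) (g : T -> 'M[R]_(p, r))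
    (A : 'M[R]_(p, q)) (B : 'M[R]_(p, r)) :
  f @ F --> A -> g @ F --> B ->
  (fun x => (f x)^T *m g x : 'M[R]_(q, r)) @ F --> (A^T *m B : 'M[R]_(q, r)).
Proof.
move=> fA gB U [P nP PU].
have h i j : F [set x | P i j (((f x)^T *m g x) i j)].
  have : (fun x => ((f x)^T *m g x) i j) @ F --> (A^T *m B) i j.
    rewrite (_ : (fun x => _) = fun x => \sum_(l < p) f x l i * g x l j).
      rewrite mxE; apply: (cvg_big add_continuous) => l _.
      rewrite mxE; apply: cvgM.
        exact: (cvg_comp _ _ fA (@coord_continuous _ _ _ l i A)).
      exact: (cvg_comp _ _ gB (@coord_continuous _ _ _ l j B)).
    by apply/funext => x; rewrite mxE; apply: eq_bigr => l _; rewrite mxE.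
  by apply; exact: nP.
have : F [set x | forall i j, P i j (((f x)^T *m g x) i j)].
  by apply: filter_forall => i; apply: filter_forall => j; exact: h.
by move=> hF; apply: (@filterS _ F _ _ _ _ hF) => x hx; exact: PU.
Qed.

Section Product.
Context {p q r : nat} (V : set 'cV[R]_m) (oV : relatively_open V).

Inductive bilinear_span : ('cV[R]_m -> 'M[R]_(q, r)) -> Prop :=
| bilinear_span_mul (f : 'cV[R]_m -> 'M[R]_(p, q)) (g : 'cV[R]_m -> 'M[R]_(p, r)) :
    smooth_on V f -> smooth_on V g ->
    bilinear_span (fun y => (f y)^T *m g y)
| bilinear_span_add f g :
    bilinear_span f -> bilinear_span g -> bilinear_span (f \+ g).

Lemma smooth_on_mulTmx (f : 'cV[R]_m -> 'M[R]_(p, q))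
    (g : 'cV[R]_m -> 'M[R]_(p, r)) :
  smooth_on V f -> smooth_on V g -> smooth_on V (fun y => (f y)^T *m g y).
Proof.
move=> sf sg; apply: (@smooth_on_coind _ V oV bilinear_span); last first.
  exact: bilinear_span_mul.
have VH y : V y -> halfspace y by case: oV => U _ -> [].
move=> h; elim=> {h f g sf sg}[f g sf sg|f g _ [cf df] _ [cg dg]].
  split.
    by move=> x; exact: (cvg_mulTmx (smooth_on_continuous sf (x := x))
      (smooth_on_continuous sg (x := x))).
  move=> k.
  exists ((fun y => (f y)^T *m pderiv k g y) \+
          (fun y => (pderiv k f y)^T *m g y)).
    exact: (bilinear_span_add (bilinear_span_mul sf (smooth_on_pderiv k sg))
      (bilinear_span_mul (smooth_on_pderiv k sf) sg)).
  move=> y Vy; have ? := increments_proper k (VH _ Vy).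
  have ft : (fun t : R => f (y + t *: delta_mx k 0)) @ increments k y --> f y.
    have t0 : (fun t : R => t) @ increments k y --> (0 : R).
      move=> A nA; apply: (@filterS _ (0 : R)^' _ A); first by move=> t At _.
      exact: nbhs_dnbhs nA.
    have := cvgD (cvg_cst (f y)) (cvgZ t0 (smooth_on_cvg (k := k) sf Vy)).
    rewrite scale0r addr0 => /(_ _ _ _); apply: cvg_trans.
    apply: near_eq_cvg.
    apply: (@filterS _ (0 : R)^' _ [set t | t != 0]); last first.
      by apply: (@filterE _ (nbhs (0 : R))).
    move=> t /= t0' _.
    by rewrite !fctE /diff_quotient scalerA mulfV// scale1r addrC subrK.
  rewrite (_ : diff_quotient _ _ _ =
    (fun t => (f (y + t *: delta_mx k 0))^T *m diff_quotient k g y t) \+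
    (fun t => (diff_quotient k f y t)^T *m g y)); last first.
    apply/funext => t; rewrite /diff_quotient /=.
    set z := y + _; have -> : (t^-1 *: (f z - f y))^T =
        t^-1 *: ((f z)^T - (f y)^T) by rewrite linearZ /= linearB.
    rewrite -[in RHS]scalemxAl -[in RHS]scalemxAr -scalerDr mulmxBr mulmxBl.
    by rewrite addrA subrK.
  apply: cvgD; first exact: cvg_mulTmx ft (smooth_on_cvg (k := k) sg Vy).
  exact: cvg_mulTmx (smooth_on_cvg (k := k) sf Vy) (cvg_cst _).
split; first by move=> x; apply: cvgD; [exact: cf|exact: cg].
move=> k; have [f' Pf' ff'] := df k; have [g' Pg' gg'] := dg k.
exists (f' \+ g'); first exact: bilinear_span_add.
move=> y Vy; have ? := increments_proper k (VH _ Vy).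
rewrite (_ : diff_quotient k (f \+ g) y =
  diff_quotient k f y \+ diff_quotient k g y); last first.
  by apply/funext => t; rewrite /diff_quotient /= -scalerDr opprD addrACA.
by apply: cvgD; [exact: ff'|exact: gg'].
Qed.

End Product.
End SmoothTheory.

Section LebesgueMeasureTuple.
Context {R : realType}.
Local Notation rT := (measurableTypeR R).

Definition cons_pair n (x : rT * n.-tuple rT) : n.+1.-tuple rT :=
  [tuple of x.1 :: x.2].

Lemma measurable_cons_pair n : measurable_fun [set: rT * n.-tuple rT] (@cons_pair n).
Proof. exact: measurable_cons. Qed.

Section Step.
Context n (nu : {sigma_finite_measure set rT -> \bar R})
  (mu : {sigma_finite_measure set (n.-tuple rT) -> \bar R}).

Definition product_cons : set (n.+1.-tuple rT) -> \bar R :=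
  pushforward (nu \x mu)%E (@cons_pair n).

Let product_cons_preimage A : measurable A -> measurable (@cons_pair n @^-1` A).
Proof.
by move=> mA; rewrite -[X in measurable X]setTI; exact: measurable_cons_pair.
Qed.

Let product_cons0 : product_cons set0 = 0%E.
Proof. by rewrite /product_cons /pushforward preimage_set0 measure0. Qed.

Let product_cons_ge0 A : (0 <= product_cons A)%E.
Proof. by rewrite /product_cons /pushforward measure_ge0. Qed.

Let product_cons_sigma_additive : semi_sigma_additive product_cons.
Proof.
move=> F mF tF mUF; rewrite /product_cons /pushforward preimage_bigcup.
apply: measure_semi_sigma_additive.
- by move=> k; exact: product_cons_preimage.
- apply/trivIsetP => /= i j _ _ ij; rewrite -preimage_setI.
  by move/trivIsetP : tF => /(_ _ _ _ _ ij) ->//; rewrite preimage_set0.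
- by rewrite -preimage_bigcup; exact: product_cons_preimage.
Qed.

HB.instance Definition _ := isMeasure.Build _ _ _ product_cons
  product_cons0 product_cons_ge0 product_cons_sigma_additive.

Let product_cons_sigma_finite : sigma_finite setT product_cons.
Proof.
have /sigma_finiteP[F [FT ndF Foo]] := sigma_finiteT nu.
have /sigma_finiteP[G [GT ndG Goo]] := sigma_finiteT mu.
pose H k := [set t : n.+1.-tuple rT | F k (thead t) /\ G k [tuple of behead t]].
exists H.
  apply/seteqP; split => // t _.
  have : [set: rT] (thead t) by []; rewrite FT => -[i _ Fi].
  have : [set: n.-tuple rT] [tuple of behead t] by []; rewrite GT => -[j _ Gj].
  exists (maxn i j) => //; split.
    by move: Fi; exact/subsetPset/ndF/leq_maxl.
  by move: Gj; exact/subsetPset/ndG/leq_maxr.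
move=> k; have [mF Fk] := Foo k; have [mG Gk] := Goo k; split.
  apply: measurableI; rewrite -[X in measurable X]setTI.
    exact: (measurable_tnth ord0).
  exact: measurable_behead.
rewrite /product_cons /pushforward (_ : _ @^-1` _ = F k `*` G k).
  by rewrite product_measure1E// lte_mul_pinfty// ge0_fin_numE.
apply/seteqP; split => -[x t] /=; rewrite /H /= theadE.
  by move=> [Fx]; rewrite (_ : [tuple of _] = t)//; apply/val_inj.
by move=> [Fx Gt]; split => //; rewrite (_ : [tuple of _] = t)//; apply/val_inj.
Qed.

HB.instance Definition _ := Measure_isSigmaFinite.Build _ _ _ product_cons
  product_cons_sigma_finite.

End Step.

Fixpoint lebesgue_tuple n : {sigma_finite_measure set (n.-tuple rT) -> \bar R} :=
  match n with
  | 0 => [the {sigma_finite_measure set (0.-tuple rT) -> \bar R} of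
          \d_([tuple] : 0.-tuple rT)]
  | n'.+1 => [the {sigma_finite_measure set (n'.+1.-tuple rT) -> \bar R} of
              product_cons (@lebesgue_measure R) (lebesgue_tuple n')]
  end.

Definition col_of_tuple n (t : n.-tuple R) : 'cV[R]_n := \col_i tnth t i.

Definition integral_Rn n (A : set 'cV[R]_n) (f : 'cV[R]_n -> R) : R :=
  \int[lebesgue_tuple n]_(t in [set t | A (col_of_tuple t)]) f (col_of_tuple t).

End LebesgueMeasureTuple.

(* A smooth m-manifold with (possibly empty) boundary, given by a smooth atlas
   of charts onto relatively open subsets of the half-space. [chart_at x] is a
   chart around x, chosen once and for all: its coordinate basis identifies the
   tangent space at x with 'cV[R]_m. *)
Record manifold (R : realType) (m : nat) := Manifold {
  points :> topologicalType;
  points_hausdorff : hausdorff_space points;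
  points_second_countable : @second_countable points;
  atlas : choiceType;
  dom : atlas -> set points;
  chart : atlas -> points -> 'cV[R]_m;
  param : atlas -> 'cV[R]_m -> points;
  chart_at : points -> atlas;
  dom_open : forall i, open (dom i);
  chart_open : forall i, relatively_open (chart i @` dom i);
  chartK : forall i x, dom i x -> param i (chart i x) = x;
  chart_continuous : forall i, {within dom i, continuous (chart i)};
  param_continuous : forall i,
    {within chart i @` dom i, continuous (param i)};
  dom_chart_at : forall x, dom (chart_at x) x;
  transition_smooth : forall i j,
    smooth_on (chart i @` (dom i `&` dom j)) (chart j \o param i)
}.

Section Tensors.
Context {R : realType} {m : nat} (M : manifold R m).
Implicit Types (i : atlas M) (x : M) (y : 'cV[R]_m).

Definition chart_image i : set 'cV[R]_m := chart i @` dom i.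

(* Its columns are the coordinate vectors of the chart i at x, expressed in the
   basis of the tangent space at x. *)
Definition chart_frame i x : 'M[R]_m :=
  jacobian (chart (chart_at x) \o param i) (chart i x).

(* A continuous choice of an orientation of all the tangent spaces, (-1) ^+ o x
   being the orientation of the distinguished basis at x. *)
Definition orientable : Prop :=
  exists o : M -> bool, forall i x, dom i x ->
    \forall z \near x, (-1) ^+ o z * Num.sg (\det (chart_frame i z)) =
                       (-1) ^+ o x * Num.sg (\det (chart_frame i x)).

(* A one-form (resp. a (0,2)-tensor field) on M is the function that maps x to
   its n x m (resp. m x m) matrix in the distinguished basis of the tangent space
   at x; what follows is its matrix in the coordinates of the chart i. That
   basis need not depend continuously on x: only the matrices in charts are
   required to be smooth. *)
Definition form_in_chart {n} i (a : M -> 'M[R]_(n, m)) y : 'M[R]_(n, m) :=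
  a (param i y) *m chart_frame i (param i y).

Definition tensor_in_chart i (h : M -> 'M[R]_m) y : 'M[R]_m :=
  (chart_frame i (param i y))^T *m h (param i y) *m chart_frame i (param i y).

Definition smooth_form {n} : pred (M -> 'M[R]_(n, m)) :=
  fun a => `[< forall i, smooth_on (chart_image i) (form_in_chart i a) >].

Definition smooth_sym_tensor : pred (M -> 'M[R]_m) :=
  fun h => `[< (forall i, smooth_on (chart_image i) (tensor_in_chart i h)) /\
               forall x, (h x)^T = h x >].

Lemma smooth_form_submod n : submod_closed (@smooth_form n).
Proof.
split.
  apply/asboolP => i.
  rewrite (_ : form_in_chart _ _ = fun=> 0); last first.
    by apply/funext => y; rewrite /form_in_chart mul0mx.
  by apply: smooth_on0; exact: chart_open.
move=> c a b /asboolP sa /asboolP sb; apply/asboolP => i.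
rewrite (_ : form_in_chart _ _ = (c \*: form_in_chart i a) \+ form_in_chart i b).
  by apply: smooth_onD; [exact: chart_open|apply: smooth_onZ => //; exact: chart_open|].
by apply/funext => y; rewrite /form_in_chart !fctE mulmxDl -scalemxAl.
Qed.

Lemma smooth_sym_tensor_submod : submod_closed smooth_sym_tensor.
Proof.
split.
  apply/asboolP; split => [i|x]; last by rewrite trmx0.
  rewrite (_ : tensor_in_chart _ _ = fun=> 0); last first.
    by apply/funext => y; rewrite /tensor_in_chart mulmx0 mul0mx.
  by apply: smooth_on0; exact: chart_open.
move=> c a b /asboolP[sa ta] /asboolP[sb tb]; apply/asboolP; split => [i|x].
  rewrite (_ : tensor_in_chart _ _ =
    (c \*: tensor_in_chart i a) \+ tensor_in_chart i b).
    by apply: smooth_onD; [exact: chart_open|apply: smooth_onZ => //; exact: chart_open|].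
  apply/funext => y; rewrite /tensor_in_chart !fctE mulmxDr mulmxDl.
  by rewrite -scalemxAr -scalemxAl.
by rewrite !fctE linearD linearZ /= ta tb.
Qed.

HB.instance Definition _ n := GRing.isSubmodClosed.Build R (M -> 'M[R]_(n, m))
  (@smooth_form n) (@smooth_form_submod n).
HB.instance Definition _ := GRing.isSubmodClosed.Build R (M -> 'M[R]_m)
  smooth_sym_tensor smooth_sym_tensor_submod.
End Tensors.

Arguments smooth_form {R m} M {n} a.
Arguments smooth_sym_tensor {R m} M h.

Section Spaces.
Context {R : realType} {m : nat} (M : manifold R m).

Record one_form n := OneForm {
  form_val :> M -> 'M[R]_(n, m);
  _ : form_val \in smooth_form M
}.

HB.instance Definition _ n := [isSub for @form_val n].
HB.instance Definition _ n := [Choice of one_form n by <:].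
HB.instance Definition _ n := [SubChoice_isSubLmodule of one_form n by <:].

Record sym_tensor := SymTensor {
  tensor_val :> M -> 'M[R]_m;
  _ : tensor_val \in smooth_sym_tensor M
}.

HB.instance Definition _ := [isSub for tensor_val].
HB.instance Definition _ := [Choice of sym_tensor by <:].
HB.instance Definition _ := [SubChoice_isSubLmodule of sym_tensor by <:].
End Spaces.

Section PullbackMetric.
Context {R : realType} {m n : nat} (M : manifold R m).

Lemma pullback_metric_smooth (a : one_form M n) :
  (fun x => (a x)^T *m a x) \in smooth_sym_tensor M.
Proof.
apply/asboolP; split => [i|x]; last by rewrite trmx_mul trmxK.
have /asboolP sa : form_val a \in smooth_form M := valP a.
rewrite (_ : tensor_in_chart _ _ = fun y =>
  (form_in_chart i a y)^T *m form_in_chart i a y).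
  by apply: smooth_on_mulTmx; [exact: chart_open|exact: sa|exact: sa].
by apply/funext => y; rewrite /tensor_in_chart /form_in_chart trmx_mul !mulmxA.
Qed.

Definition pullback_metric (a : one_form M n) : sym_tensor M :=
  SymTensor (pullback_metric_smooth a).

Definition full_ranked : set (one_form M n) :=
  [set a | forall x, injective (fun v : 'cV[R]_m => a x *m v)].

Definition metrics : set (sym_tensor M) :=
  [set g | forall x (v : 'cV[R]_m), v != 0 -> 0 < (v^T *m g x *m v) 0 0].

End PullbackMetric.

Arguments pullback_metric {R m n M} a.
Arguments full_ranked {R m} n M.
Arguments metrics {R m} M.

Section Topology.
Context {R : realType} {m : nat} (M : manifold R m).

Definition jet {W : normedModType R} (f : atlas M -> 'cV[R]_m -> W)
    (p : atlas M * seq 'I_m * 'cV[R]_m) : W :=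
  pderivs p.1.2 (f p.1.1) p.2.

Definition jet_compacts : set (set (atlas M * seq 'I_m * 'cV[R]_m)) :=
  [set A | exists i w (K : set 'cV[R]_m), [/\ compact K, K `<=` chart_image i &
    A = [set p | p.1 = (i, w) /\ K p.2]]].

(* The Frechet topology: uniform convergence, on the compact subsets of the
   charts, of every iterated partial derivative of the coefficients. *)
HB.instance Definition _ n := Uniform.copy (one_form M n)
  (initial_topology (fun a : one_form M n => jet (fun i => form_in_chart i a)
     : {family jet_compacts, _ -> 'M[R]_(n, m)})).
HB.instance Definition _ := Uniform.copy (sym_tensor M)
  (initial_topology (fun h : sym_tensor M => jet (fun i => tensor_in_chart i h)
     : {family jet_compacts, _ -> 'M[R]_m})).

End Topology.

Section Integration.
Context {R : realType} {m : nat} (M : manifold R m).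

(* A finite partition of unity, each function being paired with the index of a
   chart domain that contains its support. *)
Definition partition_of_unity (P : seq (atlas M * (M -> R))) :=
  (forall p, p \in P -> [/\ continuous p.2, forall x, 0 <= p.2 x &
    closure [set x | p.2 x != 0] `<=` dom p.1]) /\
  forall x, \sum_(p <- P) p.2 x = 1.

(* The integral over a compact M of the density that reads d i in the chart i.
   By the change of variables formula it does not depend on the partition of
   unity that is used. On an oriented M, the volume form of a metric g integrates
   like the density sqrt (det g). *)
Definition integral_density (d : atlas M -> 'cV[R]_m -> R) : R :=
  \sum_(p <- xget [::] partition_of_unity)
    integral_Rn (chart_image p.1) (fun y => p.2 (param p.1 y) * d p.1 y).

Definition volume_integral (g : sym_tensor M) (f : M -> R) : R :=
  integral_density (fun i y =>
    f (param i y) * Num.sqrt (\det (tensor_in_chart i g y))).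

Definition generalized_ebin {n} (a zeta eta : one_form M n) : R :=
  integral_density (fun i y =>
    let a_y := form_in_chart i a y in
    let zeta_y := form_in_chart i zeta y in
    let eta_y := form_in_chart i eta y in
    \tr (zeta_y *m invmx (a_y^T *m a_y) *m eta_y^T) *
      Num.sqrt (\det (a_y^T *m a_y))).

Definition quarter_ebin (g h k : sym_tensor M) : R :=
  4%:R^-1 * volume_integral g (fun x =>
    \tr (h x *m invmx (g x) *m k x *m invmx (g x))).

End Integration.

Arguments generalized_ebin {R m M n} a zeta eta.
Arguments quarter_ebin {R m M} g h k.

HB.instance Definition _ (K : numDomainType) (E F : preTopologicalLmodType K) :=
  GRing.Lmodule.on (E * F)%type.

Definition is_dderiv {R : realType} {E F : preTopologicalLmodType R}
    (f : E -> F) (x v : E) (l : F) :=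
  (fun t : R => t^-1 *: (f (x + t *: v) - f x)) @ (0 : R)^' --> l.

(* Michal-Bastiani: f is C^k on the open set U when its iterated directional
   derivatives exist and are jointly continuous up to order k. *)
Fixpoint Ck {R : realType} (k : nat) {E F : preTopologicalLmodType R}
    (U : set E) (f : E -> F) : Prop :=
  {within U, continuous f} /\
  match k with
  | 0 => True
  | k'.+1 => exists2 df : E * E -> F,
      (forall x v, U x -> is_dderiv f x v (df (x, v))) &
      Ck k' (E := (E * E)%type) (U `*` [set: E]) df
  end.

Section Submersion.
Context {R : realType} {E F : preTopologicalLmodType R}.
Implicit Types (U : set E) (V : set F) (f : E -> F).

Definition is_differential f x (D : E -> F) := forall v, is_dderiv f x v (D v).

(* A smooth map whose differentials are split surjections: each has a
   continuous linear right inverse. *)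
Definition submersion U f :=
  (forall k, Ck k U f) /\
  forall x, U x -> exists2 D, is_differential f x D &
    exists s : {linear F -> E}, continuous s /\ forall w, D (s w) = w.

(* For each x, GE x and GF x are inner products on the tangent spaces E and F of
   the open sets U and V. *)
Definition riemannian_submersion U V (GE : E -> E -> E -> R)
    (GF : F -> F -> F -> R) f :=
  [/\ submersion U f, f @` U = V &
    forall x D, U x -> is_differential f x D ->
      let horizontal := [set v | forall u, D u = 0 -> GE x u v = 0] in
      set_bij horizontal [set: F] D /\
      forall v w, horizontal v -> horizontal w ->
        GF (f x) (D v) (D w) = GE x v w].

End Submersion.

(* Main.v *)
From HB Require Import structures.
Require Import Defs.
From mathcomp Require Import all_boot all_order all_algebra.
From mathcomp Require Import all_classical all_reals all_analysis.
From mathcomp Require Import measurable_realfun complex ring lra.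

Set Implicit Arguments.
Unset Strict Implicit.
Unset Printing Implicit Defensive.

Import Order.TTheory GRing.Theory Num.Theory.
Import numFieldNormedType.Exports.

Local Open Scope classical_set_scope.
Local Open Scope ring_scope.

(** The map a |-> a^T a is quadratic. Its polarization
    B(a, b) = (a^T b + b^T a) / 2 is continuous for the Fréchet topologies by
    Leibniz's rule (sym_product_cvg), hence the map is smooth, all its iterated
    differentials being sums of terms B(L1, L2) with L1, L2 continuous and linear
    (quadratic_Ck), and its differential at a is D v = a^T v + v^T a.

    Let g = a^T a. For a symmetric tensor field h, the one-form
    lift(h) = a g^-1 h / 2 satisfies D (lift h) = h (horizontal_liftK), so that the
    differential is split by a continuous linear map. If D u = 0, the matrix a^T u
    is antisymmetric at each point, while
    2 tr (u g^-1 lift(h)^T) = tr (a^T u g^-1 h g^-1) pairs it with a symmetric one: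
    u and lift(h) are orthogonal, even pointwise. Conversely v - lift(D v) is
    vertical, and if v is horizontal then G(v - lift(D v), v - lift(D v)) =
    G(v - lift(D v), v) = 0, so v = lift(D v) because G is definite. Hence the
    horizontal vectors are the lifts (horizontalP), on which D is a bijection, and
    it is an isometry because
    tr (lift(h) g^-1 lift(k)^T) = tr (h g^-1 k g^-1) / 4 (trace_lift_mx).

    The image is the whole space of metrics as soon as there is one full-ranked
    form a0: with g0 = a0^T a0, a metric g is the pullback by a0 g0^-1 s, where s
    is the geometric mean of g0 and g, i.e. the positive definite solution of
    s g0^-1 s = g (pullback_metric_surjective). It is unique, hence given by the
    same equation in every chart, and it depends smoothly on the point: this comes
    down to the smoothness of the square root of a positive definite matrix, whose
    derivative solves a Sylvester equation (smooth_on_sqrt).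

    Two facts about manifolds with boundary enter. The frames of the charts are
    invertible, by the chain rule up to the boundary (chart_frame_unit). And G is
    definite (generalized_ebin_definite): a finite partition of unity exists on the
    compact M, its terms have compact support in the charts, so that all integrals
    are finite, and a nonnegative continuous function on a relatively open subset
    of the half-space whose integral is zero vanishes. *)

(** * Calculus on relatively open subsets of the half-space *)

Section Calculus.
Context {R : realType} {m : nat}.
Implicit Types (y : 'cV[R]_m) (k : 'I_m) (V : set 'cV[R]_m).

Lemma relatively_open_halfspace V y : relatively_open V -> V y -> halfspace y.
Proof. by case=> U _ -> []. Qed.

(** This is how the overlap of two charts, and the set where a continuous
    function is larger than a constant, are seen to be relatively open. *)
Lemma relatively_open_preimage (T : topologicalType) V (f : 'cV[R]_m -> T) (B : set T) :
  relatively_open V -> {within V, continuous f} -> open B ->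
  relatively_open (V `&` f @^-1` B).
Proof.
move=> [U oU VE] /continuousP cf oB; have := cf B oB => /(open_subspaceP _ _).1[C oC CE].
exists (C `&` U); first exact: openI.
by rewrite -setIA -VE CE setIC.
Qed.

Lemma increments_cvg0 k y : (fun t : R => t) @ increments k y --> (0 : R).
Proof.
move=> A nA; apply: (@filterS _ (0 : R)^' _ A); first by move=> t At _.
exact: nbhs_dnbhs nA.
Qed.

Lemma increments_neq0 k y : \forall t \near increments k y, t != 0.
Proof.
apply: (@filterS _ (0 : R)^' _ [set t | t != 0]); last first.
  by apply: (@filterE _ (nbhs (0 : R))).
by move=> t /= t0 _.
Qed.

Section Normed.
Context {W : normedModType R} V (oV : relatively_open V).
Implicit Types f g : 'cV[R]_m -> W.

Lemma pderivs_rcons w k f : pderivs (rcons w k) f = pderivs w (pderiv k f).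
Proof. by rewrite /pderivs foldr_rcons. Qed.

(** The two families of difference quotients have the same image filter, so that
    their lim agree even where no limit exists. A field in a chart may thus be
    replaced by any formula for it that holds on the chart image. *)
Lemma pderiv_eq f g k : (forall z, V z -> f z = g z) ->
  forall y, V y -> pderiv k f y = pderiv k g y.
Proof.
move=> fg y Vy; rewrite /pderiv; congr (lim _).
have fg' z : V z -> g z = f z by move=> /fg.
have e1 := diff_quotient_eq_near oV k fg Vy.
have e2 := diff_quotient_eq_near oV k fg' Vy.
apply/seteqP; split => A.
  by apply: near_eq_cvg.
by apply: near_eq_cvg.
Qed.

Lemma pderivs_eq f g w : (forall z, V z -> f z = g z) ->
  forall y, V y -> pderivs w f y = pderivs w g y.
Proof. by move=> fg; elim: w => //= k w IH; apply: pderiv_eq. Qed.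

Lemma within_continuous_eq f g : (forall z, V z -> f z = g z) ->
  {within V, continuous f} -> {within V, continuous g}.
Proof.
move=> fg /subspace_continuousP cf; apply/subspace_continuousP => y Vy.
have := cf y Vy; rewrite /from_subspace -(fg y Vy); apply: cvg_trans.
apply: near_eq_cvg; apply: (@filterE _ (nbhs y)) => z Vz.
by rewrite /from_subspace fg.
Qed.

Lemma smooth_on_eq f g : (forall z, V z -> f z = g z) ->
  smooth_on V f -> smooth_on V g.
Proof.
move=> fg sf; apply: (@smooth_on_coind R m W V oV
  (fun h => exists2 f, smooth_on V f & forall z, V z -> f z = h z)); last by exists f.
move=> {sf fg}h [{}f sf fg]; split.
  exact: within_continuous_eq fg (smooth_on_continuous sf).
move=> k; exists (pderiv k f); first by exists (pderiv k f) => //; exact: smooth_on_pderiv.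
by move=> y Vy; apply: (diff_quotient_eq_cvg oV fg Vy); exact: smooth_on_cvg.
Qed.

Lemma diff_quotient_continuous f k y (l : W) : V y ->
  diff_quotient k f y @ increments k y --> l ->
  (fun t : R => f (y + t *: delta_mx k 0)) @ increments k y --> f y.
Proof.
move=> Vy fl; have ? := increments_proper k (relatively_open_halfspace oV Vy).
have := cvgD (cvg_cst (f y)) (cvgZ (@increments_cvg0 k y) fl).
rewrite scale0r addr0 => /(_ _ _ _); apply: cvg_trans; apply: near_eq_cvg.
apply: filterS (increments_neq0 k y) => t t0.
by rewrite !fctE /diff_quotient scalerA mulfV// scale1r addrC subrK.
Qed.

Lemma diff_quotientD_cvg f g k y (a b : W) : V y ->
  diff_quotient k f y @ increments k y --> a ->
  diff_quotient k g y @ increments k y --> b ->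
  diff_quotient k (f \+ g) y @ increments k y --> a + b.
Proof.
move=> Vy fa gb; have ? := increments_proper k (relatively_open_halfspace oV Vy).
rewrite (_ : diff_quotient k (f \+ g) y =
  diff_quotient k f y \+ diff_quotient k g y); first exact: cvgD.
by apply/funext => t; rewrite /diff_quotient /= -scalerDr opprD addrACA.
Qed.

Lemma pderivD f g k : smooth_on V f -> smooth_on V g ->
  forall y, V y -> pderiv k (f \+ g) y = pderiv k f y + pderiv k g y.
Proof.
move=> sf sg y Vy; apply: (pderiv_cvg oV Vy).
by apply: diff_quotientD_cvg => //; exact: smooth_on_cvg.
Qed.

Lemma pderivsD f g w : smooth_on V f -> smooth_on V g ->
  forall y, V y -> pderivs w (f \+ g) y = pderivs w f y + pderivs w g y.
Proof.
elim/last_ind: w f g => [//|w k IH] f g sf sg y Vy.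
rewrite !pderivs_rcons.
rewrite -IH//; [|exact: smooth_on_pderiv..].
by apply: pderivs_eq => // z Vz; exact: pderivD.
Qed.

Lemma pderivZ (c : R) f k : smooth_on V f ->
  forall y, V y -> pderiv k (c \*: f) y = c *: pderiv k f y.
Proof.
move=> sf y Vy; apply: (pderiv_cvg oV Vy).
have ? := increments_proper k (relatively_open_halfspace oV Vy).
rewrite (_ : diff_quotient k (c \*: f) y = c \*: diff_quotient k f y).
  by apply: cvgZl_tmp; exact: smooth_on_cvg.
by apply/funext => t; rewrite /diff_quotient /= -scalerBr !scalerA mulrC.
Qed.

Lemma pderivsZ (c : R) f w : smooth_on V f ->
  forall y, V y -> pderivs w (c \*: f) y = c *: pderivs w f y.
Proof.
elim/last_ind: w f => [//|w k IH] f sf y Vy.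
rewrite !pderivs_rcons.
rewrite -IH//; last exact: smooth_on_pderiv.
by apply: pderivs_eq => // z Vz; exact: pderivZ.
Qed.

End Normed.

Section Scalar.
Context V (oV : relatively_open V).
Implicit Types (f g : 'cV[R]_m -> R^o) (P Q : ('cV[R]_m -> R^o) -> Prop).

Lemma diff_quotientM_cvg f g k y (a b : R^o) : V y ->
  diff_quotient k f y @ increments k y --> a ->
  diff_quotient k g y @ increments k y --> b ->
  diff_quotient k (fun z => f z * g z) y @ increments k y -->
    f y * b + a * g y.
Proof.
move=> Vy fa gb; have ? := increments_proper k (relatively_open_halfspace oV Vy).
rewrite (_ : diff_quotient k _ y =
   (fun t => f (y + t *: delta_mx k 0) * diff_quotient k g y t) \+
   (fun t => diff_quotient k f y t * g y)).
  apply: cvgD; apply: cvgM; [|exact: gb|exact: fa|exact: cvg_cst].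
  exact: (diff_quotient_continuous oV Vy fa).
apply/funext => t; rewrite /diff_quotient /= /GRing.scale /=.
by set u := f (_ + _); set v := g (_ + _); ring.
Qed.

(** Smoothness of functions that are only given implicitly is proved with
    algebra_span_smooth: exhibit a class Q of functions that contains them and
    whose members have their partial derivatives among the polynomials in
    members of Q. *)
Inductive algebra_span P : ('cV[R]_m -> R^o) -> Prop :=
| algebra_span_gen f : P f -> algebra_span P f
| algebra_span_cst c : algebra_span P (fun=> c)
| algebra_spanD f g : algebra_span P f -> algebra_span P g ->
    algebra_span P (fun y => f y + g y)
| algebra_spanM f g : algebra_span P f -> algebra_span P g ->
    algebra_span P (fun y => f y * g y).

Lemma algebra_span_sub P Q f : (forall f, P f -> Q f) ->
  algebra_span P f -> algebra_span Q f.
Proof.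
move=> PQ; elim=> [{}f /PQ Qf|c|{}f g _ ? _ ?|{}f g _ ? _ ?].
- exact: algebra_span_gen.
- exact: algebra_span_cst.
- exact: algebra_spanD.
- exact: algebra_spanM.
Qed.

Lemma algebra_span_sum P (I : Type) (r : seq I) (p : pred I) (F : I -> 'cV[R]_m -> R^o) :
  (forall i, p i -> algebra_span P (F i)) ->
  algebra_span P (fun y => \sum_(i <- r | p i) F i y).
Proof.
move=> PF; elim: r => [|i r IH].
  by under eq_fun do rewrite big_nil; exact: algebra_span_cst.
under eq_fun do rewrite big_cons.
by case: (boolP (p i)) => pi //; apply: algebra_spanD => //; exact: PF.
Qed.

Lemma algebra_span_prod P (I : Type) (r : seq I) (p : pred I) (F : I -> 'cV[R]_m -> R^o) :
  (forall i, p i -> algebra_span P (F i)) ->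
  algebra_span P (fun y => \prod_(i <- r | p i) F i y).
Proof.
move=> PF; elim: r => [|i r IH].
  by under eq_fun do rewrite big_nil; exact: algebra_span_cst.
under eq_fun do rewrite big_cons.
by case: (boolP (p i)) => pi //; apply: algebra_spanM => //; exact: PF.
Qed.

Definition differentiable_into Q f :=
  {within V, continuous f} /\ forall k, exists2 g, algebra_span Q g &
    forall y, V y -> diff_quotient k f y @ increments k y --> g y.

(** By the Leibniz rule it is enough to look at the generators. The larger
    class Q serves for generators whose derivatives involve new functions. *)
Lemma algebra_span_differentiable P Q : (forall f, P f -> Q f) ->
  (forall f, P f -> differentiable_into Q f) ->
  forall f, algebra_span P f -> differentiable_into Q f.
Proof.
move=> PQ dP f; elim=> {f}[f /dP//|c|f g _ [cf df] _ [cg dg]|f g Pf [cf df] Pg [cg dg]].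
- split; first by move=> x; exact: cvg_cst.
  move=> k; exists (fun=> 0); first exact: algebra_span_cst.
  move=> y Vy; have ? := increments_proper k (relatively_open_halfspace oV Vy).
  rewrite (_ : diff_quotient _ _ _ = fun=> 0); first exact: cvg_cst.
  by apply/funext => t; rewrite /diff_quotient subrr scaler0.
- split; first by move=> x; apply: cvgD; [exact: cf|exact: cg].
  move=> k; have [f' Pf' ff'] := df k; have [g' Pg' gg'] := dg k.
  exists (fun y => f' y + g' y); first exact: algebra_spanD.
  by move=> y Vy; exact: (diff_quotientD_cvg oV Vy (ff' y Vy) (gg' y Vy)).
- split; first by move=> x; apply: cvgM; [exact: cf|exact: cg].
  move=> k; have [f' Pf' ff'] := df k; have [g' Pg' gg'] := dg k.
  exists (fun y => f y * g' y + f' y * g y).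
    have Qf := algebra_span_sub PQ Pf; have Qg := algebra_span_sub PQ Pg.
    by apply: algebra_spanD; exact: algebra_spanM.
  by move=> y Vy; exact: diff_quotientM_cvg (ff' y Vy) (gg' y Vy).
Qed.

Lemma algebra_span_smooth Q : (forall f, Q f -> differentiable_into Q f) ->
  forall f, algebra_span Q f -> smooth_on V f.
Proof.
move=> dQ; apply: smooth_on_coind => // f Qf.
exact: (algebra_span_differentiable (fun _ => id) dQ Qf).
Qed.

Lemma smooth_on_differentiable Q f : (forall f, smooth_on V f -> Q f) ->
  smooth_on V f -> differentiable_into Q f.
Proof.
move=> sQ sf; split; first exact: smooth_on_continuous.
move=> k; exists (pderiv k f); last by move=> y; exact: smooth_on_cvg.
by apply: algebra_span_gen; apply: sQ; exact: smooth_on_pderiv.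
Qed.

Lemma algebra_span_smooth_on f : algebra_span (smooth_on V) f -> smooth_on V f.
Proof. by apply: algebra_span_smooth => {}f; exact: smooth_on_differentiable. Qed.

Lemma smooth_onM f g : smooth_on V f -> smooth_on V g ->
  smooth_on V (fun y => f y * g y).
Proof.
by move=> sf sg; apply/algebra_span_smooth_on/algebra_spanM; exact: algebra_span_gen.
Qed.

(** The derivative - f' / f^2 is a polynomial in f' and 1 / f, whence the
    hypothesis that Q contains 1 / f. *)
Lemma inv_differentiable Q f : (forall y, V y -> f y != 0) ->
  differentiable_into Q f -> Q (fun y => (f y)^-1) ->
  differentiable_into Q (fun y => (f y)^-1).
Proof.
move=> f0 [cf df] Qf; split.
  apply/subspace_continuousP => y Vy; apply: cvgV; first exact: f0.
  exact: (subspace_continuousP _ _).1 cf y Vy.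
move=> k; have [f' Pf' ff'] := df k.
exists (fun y => - 1 * (f' y * ((f y)^-1 * (f y)^-1))).
  apply: algebra_spanM; first exact: algebra_span_cst.
  by do !apply: algebra_spanM => //; exact: algebra_span_gen.
move=> y Vy; have ? := increments_proper k (relatively_open_halfspace oV Vy).
have h : (fun t => - 1 * (diff_quotient k f y t *
      ((f (y + t *: delta_mx k 0))^-1 * (f y)^-1))) @ increments k y -->
  - 1 * (f' y * ((f y)^-1 * (f y)^-1)).
  apply: cvgM; first exact: cvg_cst.
  apply: cvgM; first exact: ff'.
  apply: cvgM; last exact: cvg_cst.
  by apply: cvgV; [exact: f0|exact: diff_quotient_continuous Vy (ff' _ Vy)].
apply: cvg_trans h; apply: near_eq_cvg.
apply: filterS (increments_near k oV Vy) => t Vt.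
rewrite /diff_quotient /GRing.scale /=.
have := f0 _ Vt; have := f0 _ Vy.
move: t^-1 (f _) (f _) => u a b a0 b0.
by field; rewrite a0 b0.
Qed.

Lemma smooth_onV f : (forall y, V y -> f y != 0) -> smooth_on V f ->
  smooth_on V (fun y => (f y)^-1).
Proof.
move=> f0 sf; pose Q g := smooth_on V g \/ g = fun y => (f y)^-1.
apply: (@algebra_span_smooth Q); last by apply: algebra_span_gen; right.
move=> h [sg|->]; first by apply: smooth_on_differentiable => // ?; left.
apply: inv_differentiable => //; last by right.
by apply: smooth_on_differentiable => // ?; left.
Qed.

End Scalar.
End Calculus.

Lemma cvg_mxP {R : realType} {T : Type} {F : set_system T} {FF : Filter F} {p q : nat}
    (f : T -> 'M[R]_(p, q)) (A : 'M[R]_(p, q)) :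
  f @ F --> A <-> forall i j, (fun x => f x i j) @ F --> A i j.
Proof.
split=> [fA i j|fA U [P nP PU]].
  exact: (cvg_comp _ _ fA (@coord_continuous _ _ _ i j A)).
have : F [set x | forall i j, P i j (f x i j)].
  by apply: filter_forall => i; apply: filter_forall => j; exact: fA.
by move=> hF; apply: (@filterS _ F _ _ _ _ hF) => x hx; exact: PU.
Qed.

Section MatrixCalculus.
Context {R : realType} {m : nat} (V : set 'cV[R]_m) (oV : relatively_open V).
Implicit Types (y : 'cV[R]_m) (k : 'I_m).

Lemma diff_quotient_mx_cvg p q (f : 'cV[R]_m -> 'M[R]_(p, q)) k y (l : 'M[R]_(p, q)) :
  V y -> diff_quotient k f y @ increments k y --> l <->
  forall i j, diff_quotient k (fun z => f z i j : R^o) y @ increments k y --> l i j.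
Proof.
move=> Vy; have ? := increments_proper k (relatively_open_halfspace oV Vy).
have E i j : diff_quotient k (fun z => f z i j : R^o) y =
    fun t => diff_quotient k f y t i j.
  by apply/funext => t; rewrite /diff_quotient !mxE.
by split=> [/cvg_mxP h i j|h]; [rewrite E|apply/cvg_mxP => i j; rewrite -E].
Qed.

Lemma smooth_on_mxP p q (f : 'cV[R]_m -> 'M[R]_(p, q)) :
  smooth_on V f <-> forall i j, smooth_on V (fun y => f y i j : R^o).
Proof.
split=> [sf i j|].
  apply: (@smooth_on_coind _ _ _ _ oV (fun h =>
    exists2 f : 'cV[R]_m -> 'M[R]_(p, q), smooth_on V f &
      h = fun y => f y i j)); last by exists f.
  move=> h [{sf}f sf ->]; split.
    apply/subspace_continuousP => y Vy.
    exact: (cvg_mxP _ _).1 ((subspace_continuousP _ _).1 (smooth_on_continuous sf) y Vy) i j.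
  move=> k; exists (fun y => pderiv k f y i j).
    by exists (pderiv k f); [exact: smooth_on_pderiv|reflexivity].
  by move=> y Vy; exact: (diff_quotient_mx_cvg _ _ _ Vy).1 (smooth_on_cvg sf Vy) i j.
apply: (@smooth_on_coind _ _ _ _ oV (fun f : 'cV[R]_m -> 'M[R]_(p, q) =>
  forall i j, smooth_on V (fun y => f y i j : R^o))).
move=> {}f sf; split.
  apply/subspace_continuousP => y Vy; apply/cvg_mxP => i j.
  exact: (subspace_continuousP _ _).1 (smooth_on_continuous (sf i j)) y Vy.
move=> k; exists (fun y => \matrix_(i, j) pderiv k (fun y => f y i j : R^o) y).
  move=> i j; under eq_fun do rewrite mxE; exact: smooth_on_pderiv.
move=> y Vy; apply/(diff_quotient_mx_cvg _ _ _ Vy) => i j; rewrite mxE.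
exact: smooth_on_cvg.
Qed.

Lemma pderiv_mxE p q (f : 'cV[R]_m -> 'M[R]_(p, q)) k i j y :
  smooth_on V f -> V y ->
  pderiv k f y i j = pderiv k (fun z => f z i j : R^o) y.
Proof.
move=> sf Vy; symmetry; apply: (pderiv_cvg oV Vy).
exact: (diff_quotient_mx_cvg _ _ _ Vy).1 (smooth_on_cvg sf Vy) i j.
Qed.

Lemma pderivs_mxE p q (f : 'cV[R]_m -> 'M[R]_(p, q)) w i j y :
  smooth_on V f -> V y ->
  pderivs w f y i j = pderivs w (fun z => f z i j : R^o) y.
Proof.
elim/last_ind: w f => [//|w k IH] f sf Vy.
rewrite !pderivs_rcons (IH _ (smooth_on_pderiv k sf) Vy).
by apply: (pderivs_eq oV) => // z Vz; exact: pderiv_mxE.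
Qed.

Lemma algebra_span_mulmx P p q r (A : 'cV[R]_m -> 'M[R]_(p, q)) (B : 'cV[R]_m -> 'M[R]_(q, r)) :
  (forall i j, algebra_span P (fun y => A y i j)) ->
  (forall i j, algebra_span P (fun y => B y i j)) ->
  forall i j, algebra_span P (fun y => (A y *m B y) i j).
Proof.
move=> PA PB i j; under eq_fun do rewrite mxE.
by apply: algebra_span_sum => l _; exact: algebra_spanM.
Qed.

Lemma algebra_span_det P p (A : 'cV[R]_m -> 'M[R]_p) :
  (forall i j, algebra_span P (fun y => A y i j)) ->
  algebra_span P (fun y => \det (A y)).
Proof.
move=> PA; rewrite /determinant; apply: algebra_span_sum => s _.
by apply: algebra_spanM; [exact: algebra_span_cst|apply: algebra_span_prod => i _].
Qed.

(** By Cramer's rule the entries of the inverse are polynomials in the entries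
    and in the inverse of the determinant; that formula holds on V only. *)
Lemma algebra_span_invmx P p (A : 'cV[R]_m -> 'M[R]_p) :
  (forall y, V y -> A y \in unitmx) ->
  (forall i j, algebra_span P (fun y => A y i j)) ->
  P (fun y => (\det (A y))^-1) ->
  exists2 B : 'cV[R]_m -> 'M[R]_p, (forall i j, algebra_span P (fun y => B y i j)) &
    forall y, V y -> B y = invmx (A y).
Proof.
move=> Au PA PD; exists (fun y => (\det (A y))^-1 *: \adj (A y)).
  move=> i j; under eq_fun do rewrite !mxE.
  apply: algebra_spanM; first exact: algebra_span_gen.
  apply: algebra_spanM; first exact: algebra_span_cst.
  by apply: algebra_span_det => a b; under eq_fun do rewrite !mxE.
by move=> y /Au; rewrite /invmx => ->.
Qed.

Lemma smooth_on_mulmx p q r (A : 'cV[R]_m -> 'M[R]_(p, q)) (B : 'cV[R]_m -> 'M[R]_(q, r)) :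
  smooth_on V A -> smooth_on V B -> smooth_on V (fun y => A y *m B y).
Proof.
move=> /smooth_on_mxP sA /smooth_on_mxP sB; apply/smooth_on_mxP => i j.
apply: algebra_span_smooth_on => //.
by apply: algebra_span_mulmx => a b; exact: algebra_span_gen.
Qed.

Lemma smooth_on_trmx p q (A : 'cV[R]_m -> 'M[R]_(p, q)) :
  smooth_on V A -> smooth_on V (fun y => (A y)^T).
Proof.
move=> /smooth_on_mxP sA; apply/smooth_on_mxP => i j.
by under eq_fun do rewrite mxE; exact: sA.
Qed.

Lemma smooth_on_det p (A : 'cV[R]_m -> 'M[R]_p) :
  smooth_on V A -> smooth_on V (fun y => \det (A y) : R^o).
Proof.
move=> /smooth_on_mxP sA; apply: algebra_span_smooth_on => //.
by apply: algebra_span_det => i j; exact: algebra_span_gen.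
Qed.

Lemma smooth_on_invmx p (A : 'cV[R]_m -> 'M[R]_p) :
  (forall y, V y -> A y \in unitmx) ->
  smooth_on V A -> smooth_on V (fun y => invmx (A y)).
Proof.
move=> Au sA; have sD : smooth_on V (fun y => (\det (A y))^-1 : R^o).
  apply: (smooth_onV oV); last exact: smooth_on_det.
  by move=> y /Au; rewrite unitmxE unitfE.
have [|B sB BA] := algebra_span_invmx Au _ sD.
  by move=> i j; apply/algebra_span_gen/(smooth_on_mxP A).1.
apply: (smooth_on_eq oV BA); apply/smooth_on_mxP => i j.
exact: algebra_span_smooth_on.
Qed.

End MatrixCalculus.

(** * The chain rule and the frames of the charts *)

Lemma mx_norm_leP {R : realType} p q (x : 'M[R]_(p, q)) (e : R) : 0 <= e ->
  `|x| <= e <-> forall i j, `|x i j| <= e.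
Proof.
move=> e0; have -> : `|x| = mx_norm x by [].
rewrite mx_normrE; split=> [/bigmax_leP[_ h] i j|h]; first exact: (h (i, j)).
by apply/bigmax_leP; split=> // -[i j] _; exact: h.
Qed.

Lemma mx_norm_ltP {R : realType} p q (x : 'M[R]_(p, q)) (e : R) : 0 < e ->
  `|x| < e <-> forall i j, `|x i j| < e.
Proof.
move=> e0; have -> : `|x| = mx_norm x by [].
rewrite mx_normrE; split=> [/bigmax_ltP[_ h] i j|h]; first exact: (h (i, j)).
by apply/bigmax_ltP; split=> // -[i j] _; exact: h.
Qed.

Lemma nbhs_colP {R : realType} m (z : 'cV[R]_m) (A : set 'cV[R]_m) :
  nbhs z A <-> exists2 e : R, 0 < e &
    forall h : 'cV[R]_m, (forall k, `|h k 0| < e) -> A (z + h).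
Proof.
split=> [/nbhs_normP[e /= e0 he]|[e e0 he]].
  exists e => // h hh; apply: he => /=; rewrite opprD addrA subrr sub0r normrN.
  by apply/mx_norm_ltP => // i j; rewrite (ord1 j).
apply/(nbhs_normP z A); exists e => //= h /(mx_norm_ltP _ e0) hh.
rewrite -(subrK z h) addrC; apply: he => k.
by rewrite -opprB mxE normrN; exact: hh.
Qed.

Section Differentiability.
Context {R : realType} {m : nat} (V : set 'cV[R]_m) (oV : relatively_open V).
Implicit Types (y z h : 'cV[R]_m) (k : 'I_m) (f : 'cV[R]_m -> R^o).

(** In the interior of the segment the one-sided increments of the partial
    derivative contain all small increments, so that it is a two-sided
    derivative there and the mean value theorem applies. *)
Lemma segment_MVT f k y (s : R) : smooth_on V f -> 0 <= s ->
  (forall t, 0 <= t <= s -> V (y + t *: delta_mx k 0)) ->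
  exists2 t, 0 <= t <= s &
    f (y + s *: delta_mx k 0) - f y = pderiv k f (y + t *: delta_mx k 0) * s.
Proof.
move=> sf s0 Vs; pose u t := f (y + t *: delta_mx k 0).
have cts : continuous (fun t : R => y + t *: (delta_mx k 0 : 'cV[R]_m)).
  move=> t; apply: cvgD; first exact: cvg_cst.
  by apply: cvgZr_tmp; exact: cvg_id.
have [||t] := @MVT_segment R u (fun t => pderiv k f (y + t *: delta_mx k 0)) 0 s s0.
- move=> t; rewrite in_itv /= => /andP[t0 ts].
  have Vt : V (y + t *: delta_mx k 0) by apply: Vs; rewrite !ltW.
  have h : (fun x : R => x^-1 *: ((u \o shift t) (x *: 1) - u t)) @ 0^' -->
      pderiv k f (y + t *: delta_mx k 0).
    apply: cvg_trans (smooth_on_cvg (k := k) sf Vt).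
    move=> A; rewrite /increments /within /=.
    have nt : \forall x \near (0 : R)^', 0 <= x + t <= s.
      apply: (@nbhs_dnbhs _ (0 : R)).
      have : \forall x \near (0 : R), x \in `]- t, s - t[.
        by apply: near_in_itvoo; rewrite in_itv /= oppr_lt0 t0 subr_gt0.
      by apply: filterS => x; rewrite in_itv /= => /andP[? ?]; apply/andP; split; lra.
    apply: filterS2 nt => x xs Ax /=.
    have E : y + (x + t) *: delta_mx k 0 = y + t *: delta_mx k 0 + x *: delta_mx k 0.
      by rewrite scalerDl [x *: _ + _]addrC addrA.
    rewrite /u /= [x *: 1]mulr1 E; apply: Ax; rewrite -E.
    by apply: (relatively_open_halfspace oV); exact: Vs.
  split; first by apply/cvg_ex; exists (pderiv k f (y + t *: delta_mx k 0)).
  exact: (cvg_lim _ h).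
- apply/subspace_continuousP => t; rewrite /= in_itv /= => ts.
  rewrite /from_subspace /u.
  have := (subspace_continuousP _ _).1 (smooth_on_continuous sf) _ (Vs t ts).
  apply: (@cvg_comp _ _ _ (fun t : R => y + t *: (delta_mx k 0 : 'cV[R]_m))
    (f : subspace V -> _)).
  move=> A hA; have h := cts t _ hA; rewrite /within /=.
  apply: (@filterS _ (nbhs t) _ _ _ _ h) => x Ax.
  by rewrite /= in_itv /= => xs; apply: Ax; apply: Vs.
rewrite in_itv /= => ts; rewrite /u scale0r addr0 subr0 => e.
by exists t.
Qed.

Lemma segment_estimate f k y (s c e : R) : smooth_on V f ->
  (forall t, 0 <= t <= s \/ s <= t <= 0 -> V (y + t *: delta_mx k 0) /\
     `|pderiv k f (y + t *: delta_mx k 0) - c| <= e) ->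
  `|f (y + s *: delta_mx k 0) - f y - s * c| <= e * `|s|.
Proof.
move=> sf Vs; have [s0|s0] := leP 0 s.
  have [|t ts ->] := segment_MVT (k := k) (y := y) sf s0.
    by move=> t ts; have [] := Vs t (or_introl ts).
  rewrite mulrC -mulrBr normrM mulrC ler_wpM2r//.
  by have [] := Vs t (or_introl ts).
have s0' : 0 <= - s by rewrite oppr_ge0 ltW.
have E t : y + s *: delta_mx k 0 + t *: delta_mx k 0 = y + (s + t) *: delta_mx k 0.
  by rewrite scalerDl addrA.
have [|t ts] := segment_MVT (k := k) (y := y + s *: delta_mx k 0) sf s0'.
  move=> t /andP[t0 ts]; rewrite E; have [|//] := Vs (s + t).
  by right; apply/andP; split; lra.
rewrite !E subrr scale0r addr0 => H.
have -> : f (y + s *: delta_mx k 0) - f y - s * c =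
  (pderiv k f (y + (s + t) *: delta_mx k 0) - c) * s.
  rewrite -[f _ - f y]opprB H; ring.
rewrite normrM ler_wpM2r//; have [|//] := Vs (s + t).
by case/andP: ts => ? ?; right; apply/andP; split; lra.
Qed.

(** The increment that has already been made when the coordinates are changed
    one after the other. *)
Definition head_part (h : 'cV[R]_m) l : 'cV[R]_m := \col_i (if (i < l)%N then h i 0 else 0).

(** The half-space is a product of intervals: changing the coordinates one at
    a time does not leave it. *)
Lemma halfspace_between z h (g : 'cV[R]_m) : halfspace z -> halfspace (z + h) ->
  (forall i, 0 <= g i 0 <= h i 0 \/ h i 0 <= g i 0 <= 0) -> halfspace (z + g).
Proof.
move=> Hz Hh hg k k0; have := Hz k k0; have := Hh k k0; rewrite !mxE.
by case: (hg k) => /andP[? ?]; lra.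
Qed.

(** Continuous partial derivatives give differentiability, also at boundary
    points: f (z + h) - f z telescopes along the edges of the box spanned by
    z and z + h, and each edge is treated by the mean value theorem. *)
Lemma smooth_on_frechet f z (e : R) : smooth_on V f -> V z -> 0 < e ->
  exists2 d : R, 0 < d & forall h : 'cV[R]_m, (forall i, `|h i 0| < d) -> halfspace (z + h) ->
    V (z + h) /\
    `|f (z + h) - f z - \sum_k h k 0 * pderiv k f z| <= e * \sum_k `|h k 0|.
Proof.
move=> sf Vz e0.
have [d d0 Hd] : exists2 d : R, 0 < d &
    forall h : 'cV[R]_m, (forall i, `|h i 0| < d) -> halfspace (z + h) ->
    V (z + h) /\ forall k, `|pderiv k f (z + h) - pderiv k f z| <= e.
  have [U oU VE] := oV.
  have [a a0 Ha] : exists2 a : R, 0 < a &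
      forall h : 'cV[R]_m, (forall i, `|h i 0| < a) -> U (z + h).
    by apply/nbhs_colP; move: Vz; rewrite VE => -[Uz _]; exact: open_nbhs_nbhs.
  have [b b0 Hb] : exists2 b : R, 0 < b & forall h : 'cV[R]_m, (forall i, `|h i 0| < b) ->
      V (z + h) -> forall k, `|pderiv k f (z + h) - pderiv k f z| <= e.
    apply: (nbhs_colP z [set x | V x -> forall k, `|pderiv k f x - pderiv k f z| <= e]).1.
    have : nbhs z [set x | forall k, V x -> `|pderiv k f x - pderiv k f z| <= e].
      apply: (@filter_forall _ _ (fun k =>
        [set x | V x -> `|pderiv k f x - pderiv k f z| <= e]) (nbhs z)) => k.
      have := (subspace_continuousP _ _).1
        (smooth_on_continuous (smooth_on_pderiv k sf)) z Vz.
      by move=> /cvgr_distC_le/(_ e e0).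
    by apply: filterS => x h Vx k; exact: h.
  exists (Num.min a b); first by rewrite lt_min a0.
  move=> h hh Hh; have Vh : V (z + h).
    by rewrite VE; split => //; apply: Ha => i; have := hh i; rewrite lt_min => /andP[].
  by split=> // k; apply: Hb => // i; have := hh i; rewrite lt_min => /andP[].
exists d => // h hh Hh; split; first by have [] := Hd h hh Hh.
have Hz := relatively_open_halfspace oV Vz.
have hpE l : l = m -> head_part h l = h.
  by move=> ->; apply/colP => i; rewrite mxE ltn_ord.
have hp0 : head_part h 0 = 0 by apply/colP => i; rewrite !mxE.
have hpS (l : 'I_m) : head_part h l.+1 = head_part h l + h l 0 *: delta_mx l 0.
  apply/colP => i; rewrite !mxE eqxx andbT ltnS.
  have [->|il] := eqVneq i l; first by rewrite leqnn ltnn mulr1 add0r.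
  by rewrite mulr0 addr0 leq_eqVlt (negbTE (il : (i : nat) != l)).
have fE : f (z + h) - f z =
    \sum_(l < m) (f (z + head_part h l.+1) - f (z + head_part h l)).
  rewrite -(big_mkord xpredT (fun l => f (z + head_part h l.+1) - f (z + head_part h l))).
  by rewrite telescope_sumr// hp0 (hpE m erefl) addr0.
rewrite fE -sumrB mulr_sumr; apply: le_trans (ler_norm_sum _ _ _) _.
apply: ler_sum => l _; rewrite hpS addrA.
apply: segment_estimate => // t ht; rewrite -addrA.
have bt i : 0 <= (head_part h l + t *: delta_mx l 0) i 0 <= h i 0 \/
   h i 0 <= (head_part h l + t *: delta_mx l 0) i 0 <= 0.
  rewrite !mxE eqxx andbT; have [->|il] := eqVneq i l.
    by rewrite ltnn add0r mulr1.
  rewrite mulr0 addr0.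
  by case: ifP => _; have [?|?] := leP 0 (h i 0); [left|right|left|right];
    apply/andP; split; lra.
have [||Vt Ht] := Hd (head_part h l + t *: delta_mx l 0).
- move=> i; apply: le_lt_trans (hh i).
  case: (bt i) => /andP[b1 b2]; rewrite ler_norml.
    by rewrite (ger0_norm (le_trans b1 b2)); apply/andP; split; lra.
  by rewrite (ler0_norm (le_trans b1 b2)); apply/andP; split; lra.
- exact: halfspace_between Hz Hh bt.
by split.
Qed.

End Differentiability.

Section ChainRule.
Context {R : realType} {m p : nat}.
Context (V : set 'cV[R]_m) (oV : relatively_open V).
Context (V' : set 'cV[R]_p) (oV' : relatively_open V').
Implicit Types (y : 'cV[R]_m) (k : 'I_m).

(** Along g (y + t *: e_k) the increment of g is in general not parallel to an axis,
    which is why f has to be differentiable in the full sense of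
    smooth_on_frechet. *)
Lemma chain_rule_cvg (f : 'cV[R]_p -> R^o) (g : 'cV[R]_m -> 'cV[R]_p) k y :
  smooth_on V' f -> smooth_on V g -> V y -> (forall z, V z -> V' (g z)) ->
  diff_quotient k (fun z => f (g z)) y @ increments k y -->
    \sum_l pderiv k g y l 0 * pderiv l f (g y).
Proof.
move=> sf sg Vy gV; have ? := increments_proper k (relatively_open_halfspace oV Vy).
have gl := smooth_on_cvg (k := k) sg Vy.
have gc := diff_quotient_continuous oV Vy gl.
set w := diff_quotient k g y.
have wl l : (fun t => w t l 0) @ increments k y --> pderiv k g y l 0.
  exact: (cvg_mxP _ _).1 gl l 0.
pose r t := f (g (y + t *: delta_mx k 0)) - f (g y) -
  \sum_l (t * w t l 0) * pderiv l f (g y).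
have lin : (fun t => \sum_l w t l 0 * pderiv l f (g y)) @ increments k y -->
    \sum_l pderiv k g y l 0 * pderiv l f (g y).
  by apply: (cvg_big add_continuous) => l _; apply: cvgM; [exact: wl|exact: cvg_cst].
have r0 : (fun t => t^-1 * r t) @ increments k y --> (0 : R).
  apply/cvgrPdist_le => e e0.
  set S := \sum_l `|pderiv k g y l 0| + 1.
  have S0 : 0 < S by rewrite ltr_wpDl// sumr_ge0.
  have [d d0 Hd] := smooth_on_frechet oV' sf (gV _ Vy) (divr_gt0 e0 S0).
  have nS : \forall t \near increments k y, \sum_l `|w t l 0| < S.
    have : (fun t => \sum_l `|w t l 0|) @ increments k y --> \sum_l `|pderiv k g y l 0|.
      by apply: (cvg_big add_continuous) => l _; apply: cvg_norm; exact: wl.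
    by move=> /cvgr_lt; apply; rewrite ltrDl.
  have nd : \forall t \near increments k y,
      forall l, `|(g (y + t *: delta_mx k 0) - g y) l 0| < d.
    have : (fun t => `|g (y + t *: delta_mx k 0) - g y|) @ increments k y --> (0 : R).
      rewrite -(normr0 'cV[R]_p) -(subrr (g y)); apply: cvg_norm.
      by apply: cvgB => //; exact: cvg_cst.
    move=> /cvgr_lt/(_ _ d0); apply: filterS => t /(mx_norm_ltP _ d0) h l.
    exact: h.
  have nV := increments_near k oV Vy; have n0 := increments_neq0 k y.
  near=> t.
  have t0 : t != 0 by near: t.
  have tE l : t * w t l 0 = (g (y + t *: delta_mx k 0) - g y) l 0.
    by rewrite /w /diff_quotient mxE mulrA mulfV// mul1r.
  have [||_] := Hd (g (y + t *: delta_mx k 0) - g y); first by near: t.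
    rewrite subrKC; apply: (relatively_open_halfspace oV'); apply: gV.
    by near: t.
  rewrite subrKC => H; rewrite sub0r normrN normrM normfV.
  rewrite ler_pdivrMl ?normr_gt0// /r.
  rewrite (eq_bigr (fun l =>
    (g (y + t *: delta_mx k 0) - g y) l 0 * pderiv l f (g y))); last first.
    by move=> l _; rewrite tE.
  apply: le_trans H _.
  rewrite (eq_bigr (fun l => `|t| * `|w t l 0|)); last first.
    by move=> l _; rewrite -tE normrM.
  rewrite -mulr_sumr mulrCA ler_pM2l ?normr_gt0// mulrAC ler_pdivrMr//.
  by rewrite ler_pM2l//; apply: ltW; near: t.
have h : (fun t => \sum_l w t l 0 * pderiv l f (g y) + t^-1 * r t : R^o) @
    increments k y --> (\sum_l pderiv k g y l 0 * pderiv l f (g y) : R^o).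
  by rewrite -[X in _ --> X]addr0; apply: cvgD.
apply: cvg_trans h; apply: near_eq_cvg.
apply: filterS (increments_neq0 k y) => t t0.
rewrite /= /r /diff_quotient /GRing.scale /= mulrBr mulr_sumr.
rewrite addrC -addrA -sumrN -big_split /= big1 ?addr0// => l _.
by rewrite mulrA mulrA mulVf// mul1r addNr.
Unshelve. all: by end_near. Qed.

End ChainRule.

Lemma jacobian_inverse {R : realType} {m : nat} (V V' : set 'cV[R]_m)
    (f g : 'cV[R]_m -> 'cV[R]_m) y :
  relatively_open V -> relatively_open V' -> smooth_on V' f -> smooth_on V g ->
  V y -> (forall z, V z -> V' (g z)) -> (forall z, V z -> f (g z) = z) ->
  Defs.jacobian f (g y) *m Defs.jacobian g y = 1%:M.
Proof.
move=> oV oV' sf sg Vy gV fg; apply/matrixP => i k; rewrite !mxE.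
have sfi : smooth_on V' (fun z => f z i 0 : R^o) by exact: (smooth_on_mxP oV' f).1.
have H := chain_rule_cvg (k := k) oV oV' sfi sg Vy gV.
have /(pderiv_cvg oV Vy) <- :
    diff_quotient k (fun z : 'cV[R]_m => f (g z) i 0 : R^o) y @
      increments k y --> ((i == k)%:R : R^o).
  have ? := increments_proper k (relatively_open_halfspace oV Vy).
  have : (fun t : R => (i == k)%:R : R^o) @ increments k y -->
    ((i == k)%:R : R^o) by exact: cvg_cst.
  apply: cvg_trans; apply: near_eq_cvg.
  have nV := increments_near k oV Vy; have n0 := increments_neq0 k y.
  near=> t; rewrite /diff_quotient !fg//; last by near: t.
  rewrite !mxE andbT [y i 0 + _]addrC addrK [RHS]mulKf//.
  by near: t.
rewrite (pderiv_cvg oV Vy H); apply: eq_bigr => l _; rewrite !mxE mulrC.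
by rewrite (pderiv_mxE oV' l _ _ sf (gV _ Vy)).
Unshelve. all: by end_near. Qed.

Section Charts.
Context {R : realType} {m : nat} (M : manifold R m).
Implicit Types (i j : atlas M) (x : M).

Lemma chart_image_dom i y : chart_image i y -> dom i (param i y).
Proof. by move=> [x ix <-]; rewrite chartK. Qed.

Lemma paramK i y : chart_image i y -> chart i (param i y) = y.
Proof. by move=> [x ix <-]; rewrite chartK. Qed.

Lemma chart_image_chart i x : dom i x -> chart_image i (chart i x).
Proof. by exists x. Qed.

Lemma overlap_imageE i j :
  chart i @` (dom i `&` dom j) = chart_image i `&` param i @^-1` dom j.
Proof.
apply/seteqP; split=> [_ [x [ix jx] <-]|y [iy jy]].
  by split; [exact: chart_image_chart|rewrite /= chartK].
by exists (param i y); [split=> //; exact: chart_image_dom|exact: paramK].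
Qed.

Lemma overlap_image_open i j : relatively_open (chart i @` (dom i `&` dom j)).
Proof.
rewrite overlap_imageE.
exact: (relatively_open_preimage (chart_open i)
  (@param_continuous _ _ M i) (dom_open j)).
Qed.

(** The two transition maps between the charts i and chart_at x are inverse to
    each other, hence so are their Jacobian matrices. *)
Lemma chart_frame_unit i x : dom i x -> chart_frame i x \in unitmx.
Proof.
move=> ix; set j := chart_at x.
have jx : dom j x by exact: dom_chart_at.
have := @jacobian_inverse R m _ _ (chart i \o param j) (chart j \o param i) (chart i x)
  (overlap_image_open i j) (overlap_image_open j i) (transition_smooth j i)
  (transition_smooth i j).
case/(_ _ _ _)/mulmx1_unit => //.
- by exists x.
- by move=> _ [z [iz jz] <-]; exists z => //=; rewrite chartK.
- by move=> _ [z [iz jz] <-] /=; rewrite !chartK.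
Qed.

End Charts.

(** * Positive definite matrices and their geometric mean *)

Section PositiveDefinite.
Context {R : rcfType}.

Definition spd p (A : 'M[R]_p) :=
  A^T = A /\ forall v : 'cV[R]_p, v != 0 -> 0 < (v^T *m A *m v) 0 0.

Lemma dotE p (u v : 'cV[R]_p) : (u^T *m v) 0 0 = \sum_i u i 0 * v i 0.
Proof. by rewrite mxE; apply: eq_bigr => i _; rewrite mxE. Qed.

Lemma dot_gt0 p (v : 'cV[R]_p) : v != 0 -> 0 < (v^T *m v) 0 0.
Proof.
move=> v0; rewrite dotE lt0r sumr_ge0 ?andbT; last first.
  by move=> i _; rewrite -expr2 sqr_ge0.
apply: contra v0 => /eqP/psumr_eq0P v0; apply/eqP/colP => i.
rewrite mxE; apply/eqP; rewrite -sqrf_eq0 expr2; apply/eqP.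
by apply: v0 => // j _; rewrite -expr2 sqr_ge0.
Qed.

Lemma spd_ge0 p (A : 'M[R]_p) (v : 'cV[R]_p) : spd A -> 0 <= (v^T *m A *m v) 0 0.
Proof.
move=> [_ A0]; have [->|/A0/ltW//] := eqVneq v 0.
by rewrite mulmx0 mxE.
Qed.

Lemma spd_congr p q (A : 'M[R]_p) (C : 'M[R]_(p, q)) : spd A ->
  (forall v : 'cV[R]_q, v != 0 -> C *m v != 0) -> spd (C^T *m A *m C).
Proof.
move=> [AT A0] Ci; split; first by rewrite !trmx_mul trmxK AT mulmxA.
by move=> v /Ci/A0; rewrite trmx_mul !mulmxA.
Qed.

Lemma unitmx_injective p (C : 'M[R]_p) (v : 'cV[R]_p) : C \in unitmx ->
  v != 0 -> C *m v != 0.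
Proof.
by move=> Cu; apply: contra => /eqP/(congr1 (mulmx (invmx C))); rewrite mulKmx// mulmx0 => ->.
Qed.

Lemma spd1 p : spd (1%:M : 'M[R]_p).
Proof. by split=> [|v]; rewrite ?trmx1// mulmx1; exact: dot_gt0. Qed.

Lemma spd_gram p q (C : 'M[R]_(p, q)) :
  (forall v : 'cV[R]_q, v != 0 -> C *m v != 0) -> spd (C^T *m C).
Proof. by move=> Ci; rewrite -[C^T]mulmx1; apply: spd_congr => //; exact: spd1. Qed.

Lemma spd_unit p (A : 'M[R]_p) : spd A -> A \in unitmx.
Proof.
move=> [AT A0]; rewrite unitmxE unitfE; apply/negP => /det0P[v v0 vA].
have := A0 v^T; rewrite trmxK vA mul0mx mxE ltxx.
by rewrite -trmx0 (inj_eq trmx_inj) v0 => /(_ isT).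
Qed.

Lemma spd_inv p (A : 'M[R]_p) : spd A -> spd (invmx A).
Proof.
move=> sA; have Au := spd_unit sA.
have -> : invmx A = (invmx A)^T *m A *m invmx A.
  by rewrite -mulmxA mulmxV// mulmx1 trmx_inv sA.1.
apply: spd_congr => // v; apply: unitmx_injective.
by rewrite unitmx_inv.
Qed.

Lemma trace_quadratic p q (A : 'M[R]_p) (X : 'M[R]_(p, q)) :
  \tr (X^T *m A *m X) = \sum_j ((col j X)^T *m A *m col j X) 0 0.
Proof.
apply: eq_bigr => j _.
rewrite tr_col -row_mul; move: (X^T *m A) => B.
by rewrite !mxE; apply: eq_bigr => i _; rewrite !mxE.
Qed.

Lemma trace_spd_ge0 p q (A : 'M[R]_p) (X : 'M[R]_(p, q)) : spd A ->
  0 <= \tr (X^T *m A *m X).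
Proof. by move=> sA; rewrite trace_quadratic sumr_ge0// => j _; exact: spd_ge0. Qed.

Lemma trace_spd_eq0 p q (A : 'M[R]_p) (X : 'M[R]_(p, q)) : spd A ->
  \tr (X^T *m A *m X) = 0 -> X = 0.
Proof.
move=> sA; rewrite trace_quadratic => /psumr_eq0P X0.
apply/matrixP => i j; rewrite mxE; have /eqP := X0 (fun j _ => spd_ge0 _ sA) j isT.
case: (eqVneq (col j X) 0) => [/colP/(_ i)|/sA.2]; first by rewrite !mxE.
by rewrite lt0r => /andP[/negbTE ->].
Qed.

(** tr (X^T (A X + X B)) = tr (X^T A X) + tr (X B X^T) is a sum of two
    nonnegative terms, the first of which vanishes only for X = 0. *)
Lemma spd_sylvester p (A B X : 'M[R]_p) : spd A -> spd B ->
  A *m X + X *m B = 0 -> X = 0.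
Proof.
move=> sA sB AXB; apply: (trace_spd_eq0 sA); apply/eqP; rewrite eq_le.
rewrite trace_spd_ge0// andbT.
have : \tr (X^T *m (A *m X + X *m B)) = 0 by rewrite AXB mulmx0 mxtrace0.
rewrite mulmxDr mxtraceD mulmxA => /eqP; rewrite addr_eq0 => /eqP ->.
rewrite oppr_le0 mxtrace_mulC.
by have := trace_spd_ge0 X^T sB; rewrite trmxK.
Qed.

(** S - T solves the homogeneous Sylvester equation S X + X T = 0. *)
Lemma spd_sqrt_unique p (S T : 'M[R]_p) : spd S -> spd T ->
  S *m S = T *m T -> S = T.
Proof.
move=> sS sT ST; apply/eqP; rewrite -subr_eq0; apply/eqP.
apply: (spd_sylvester sS sT).
by rewrite mulmxBr mulmxBl ST addrA subrK subrr.
Qed.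

Lemma poly_interpolation (s : seq R) (f : R -> R) :
  exists q : {poly R}, forall x, x \in s -> q.[x] = f x.
Proof.
elim: s => [|a s [q qs]]; first by exists 0.
have [as_|as_] := boolP (a \in s).
  by exists q => x; rewrite inE => /orP[/eqP->|]; exact: qs.
pose r := \prod_(b <- s) ('X - b%:P).
have ra : r.[a] != 0.
  by apply: contra as_; rewrite -rootE root_prod_XsubC.
exists (q + ((f a - q.[a]) / r.[a])%:P * r) => x; rewrite inE hornerD hornerM hornerC.
have [->|xa /= xs] := eqVneq x a; first by rewrite divfK// addrC subrK.
have /eqP -> : r.[x] == 0 by rewrite -rootE root_prod_XsubC.
by rewrite mulr0 addr0 qs.
Qed.

Lemma eigenvalue_spd_gt0 p (A : 'M[R]_p) a : spd A -> eigenvalue A a -> 0 < a.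
Proof.
move=> [AT A0] /eigenvalueP[v vA v0].
have v0' : v^T != 0 by rewrite -trmx0 (inj_eq trmx_inj).
have := A0 _ v0'; rewrite trmxK vA -scalemxAl mxE pmulr_lgt0//.
by have := dot_gt0 v0'; rewrite trmxK.
Qed.

(** By the spectral theorem over the complex numbers, the matrix is diagonalizable
    there; s lists its eigenvalues, which are real and positive. *)
Lemma spd_spectrum p (A : 'M[R]_p.+1) : spd A -> exists2 s : seq R,
  (forall a, a \in s -> 0 < a) &
  forall F : {poly R}, (forall a, a \in s -> F.[a] = 0) -> horner_mx A F = 0.
Proof.
move=> sA; pose c := real_complex R.
have Ar i j : map_mx c A i j \is Num.real by rewrite mxE; apply/complex_realP; exists (A i j).
have Ah : map_mx c A \is hermsymmx.
  apply/is_hermitianmxP; rewrite expr0 scale1r; apply/matrixP => i j.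
  by rewrite !mxE -[in LHS]sA.1 mxE; apply/esym/CrealP; have := Ar j i; rewrite mxE.
have /orthomx_spectralP := hermitian_normalmx Ah.
have /mxOverP := hermitian_spectral_diag_real Ah.
have := spectral_unit (map_mx c A).
move: (spectral_diag _) (spectralmx _) => d P Pu dr AE.
pose e i := complex.Re (d 0 i).
have dE i : d 0 i = c (e i).
  by have /complex_realP[a aE] := dr 0 i; rewrite /e aE.
exists [seq e i | i <- enum 'I_p.+1].
  (* The real number e i is an eigenvalue of A itself, as a root of its
     characteristic polynomial, which is a statement over R. *)
  move=> _ /mapP[i _ ->]; apply: (eigenvalue_spd_gt0 sA).
  suff : eigenvalue (map_mx c A) (c (e i)).
    by rewrite !eigenvalue_root_char -map_char_poly fmorph_root.
  apply/eigenvalueP; exists (row i P).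
    rewrite -dE AE -row_mul !mulmxA mulmxV// mul1mx.
    by rewrite row_mul row_diag_mx -scalemxAl -rowE.
  apply/negP => /eqP Pi0; have := mulmxV Pu => /(congr1 (row i)).
  rewrite row_mul Pi0 mul0mx => /rowP/(_ i); rewrite !mxE eqxx => /eqP.
  by rewrite eq_sym oner_eq0.
move=> F F0; apply: (@map_mx_inj _ _ c); rewrite map_horner_mx map_mx0.
rewrite AE (horner_mx_uconjC _ _ Pu) horner_mx_diag.
suff -> : map_mx (horner (map_poly c F)) d = 0 by rewrite linear0 mulmx0 mul0mx.
by apply/rowP => i; rewrite !mxE dE horner_map /= F0 ?rmorph0// map_f// mem_enum.
Qed.

Lemma horner_mx_sym p (A : 'M[R]_p.+1) (q : {poly R}) : A^T = A ->
  (horner_mx A q)^T = horner_mx A q.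
Proof.
move=> AT; elim/poly_ind: q => [|q c IH]; first by rewrite rmorph0 trmx0.
rewrite rmorphD rmorphM /= horner_mx_X horner_mx_C linearD /= tr_scalar_mx.
congr (_ + _); rewrite -[_ * A]/(_ *m A) trmx_mul IH AT.
have := @comm_horner_mx2 _ _ A 'X q; rewrite horner_mx_X => /esym.
by [].
Qed.

(** Let q be a polynomial that takes the value a^(1/4) at each eigenvalue a. Then
    T = q(A) is symmetric with T^4 = A, and T^2 is a square root of A that is
    positive definite because T is symmetric and invertible: fourth roots avoid
    any positivity argument over the complex numbers. *)
Lemma spd_sqrt_exists p (A : 'M[R]_p) : spd A -> exists2 S, spd S & S *m S = A.
Proof.
case: p A => [|p] A sA.
  by exists A => //; apply/matrixP => -[].
have [s s0 sF] := spd_spectrum sA.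
have [q qE] := poly_interpolation s (fun a => Num.sqrt (Num.sqrt a)).
pose T := horner_mx A q.
have TT : T^T = T by exact/horner_mx_sym/sA.1.
have T4 : (T *m T) *m (T *m T) = A.
  have : horner_mx A (q * q * (q * q) - 'X) = 0.
    apply: sF => a sa; rewrite hornerD hornerN hornerX !hornerM qE//.
    by rewrite -!expr2 !sqr_sqrtr ?sqrtr_ge0// ?subrr// ltW// s0.
  by rewrite rmorphB !rmorphM /= horner_mx_X => /eqP; rewrite subr_eq0 => /eqP.
have Tu : T \in unitmx.
  by have := spd_unit sA; rewrite -T4 !unitmx_mul => /andP[/andP[]].
exists (T *m T) => //; rewrite -{1}TT; apply: spd_gram => v.
exact: unitmx_injective.
Qed.

Definition sqrtmx p (A : 'M[R]_p) := xget 0 [set S | spd S /\ S *m S = A].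

Lemma sqrtmxP p (A : 'M[R]_p) : spd A -> spd (sqrtmx A) /\ sqrtmx A *m sqrtmx A = A.
Proof.
move=> sA; rewrite /sqrtmx; case: xgetP => [//|/(_ _)] H.
by have [S sS SA] := spd_sqrt_exists sA; case: (H S).
Qed.

(** The geometric mean of A and B: the positive definite solution S of the
    Riccati equation S A^-1 S = B. *)
Definition geometric_mean p (A B : 'M[R]_p) := sqrtmx A *m
  sqrtmx (invmx (sqrtmx A) *m B *m invmx (sqrtmx A)) *m sqrtmx A.

Lemma spd_conj_sym p (A C : 'M[R]_p) : spd A -> spd C -> spd (C *m A *m C).
Proof.
move=> sA sC; rewrite -{1}sC.1; apply: spd_congr => // v.
exact/unitmx_injective/spd_unit.
Qed.

Lemma geometric_meanP p (A B : 'M[R]_p) : spd A -> spd B ->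
  spd (geometric_mean A B) /\ geometric_mean A B *m invmx A *m geometric_mean A B = B.
Proof.
move=> sA sB; have [sr rr] := sqrtmxP sA; rewrite /geometric_mean.
have := sqrtmxP (spd_conj_sym sB (spd_inv sr)).
move: (sqrtmx A) sr rr => r sr rr; move: (sqrtmx _) => T [sT TT].
split; first exact: spd_conj_sym.
have ru := spd_unit sr.
have iA : invmx A = invmx r *m invmx r.
  have Au := spd_unit sA.
  rewrite -[RHS]mul1mx -(mulVmx Au) -[X in _ *m X *m _]rr.
  by rewrite !mulmxA !mulmxK.
rewrite iA !mulmxA mulmxK// -[r *m T *m invmx r *m r]mulmxA mulVmx// mulmx1.
by rewrite -[r *m T *m T]mulmxA TT !mulmxA mulmxV// mul1mx mulmxKV.
Qed.

(** With r the square root of A^-1, the matrices r S r and r T r are square roots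
    of the same matrix. *)
Lemma geometric_mean_unique p (A S T : 'M[R]_p) : spd A -> spd S -> spd T ->
  S *m invmx A *m S = T *m invmx A *m T -> S = T.
Proof.
move=> sA sS sT; have [sr rr] := sqrtmxP (spd_inv sA).
move: (sqrtmx _) sr rr => r sr <- ST; have ru := spd_unit sr.
have h : r *m S *m r = r *m T *m r.
  apply: spd_sqrt_unique; [exact: spd_conj_sym..|].
  have := congr1 (fun X => r *m X *m r) ST.
  by rewrite !mulmxA.
have := congr1 (fun X => invmx r *m X *m invmx r) h.
by rewrite !mulmxA mulVmx// !mul1mx !mulmxK.
Qed.

Lemma spd_det_gt0 p (A : 'M[R]_p) : spd A -> 0 < \det A.
Proof.
move=> sA; have [sS <-] := sqrtmxP sA; rewrite det_mulmx -expr2 lt0r sqr_ge0 andbT.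
by rewrite expf_neq0// -unitfE -unitmxE spd_unit.
Qed.

End PositiveDefinite.

(** * Smoothness of the square root of a positive definite matrix *)

Section MatrixLimits.
Context {R : realType} {T : Type} {F : set_system T} {FF : Filter F}.

Lemma cvg_mulmx p q r (f : T -> 'M[R]_(p, q)) (g : T -> 'M[R]_(q, r))
    (A : 'M[R]_(p, q)) (B : 'M[R]_(q, r)) :
  f @ F --> A -> g @ F --> B -> (fun x => f x *m g x) @ F --> A *m B.
Proof.
move=> /cvg_mxP fA /cvg_mxP gB; apply/cvg_mxP => i j.
under eq_fun do rewrite mxE; rewrite mxE.
by apply: (cvg_big add_continuous) => l _; exact: cvgM.
Qed.

Lemma cvg_trmx p q (f : T -> 'M[R]_(p, q)) (A : 'M[R]_(p, q)) :
  f @ F --> A -> (fun x => (f x)^T) @ F --> A^T.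
Proof.
move=> /cvg_mxP fA; apply/cvg_mxP => i j.
by under eq_fun do rewrite mxE; rewrite mxE; exact: fA.
Qed.

Lemma cvg_mxtrace p (f : T -> 'M[R]_p) (A : 'M[R]_p) :
  f @ F --> A -> (fun x => \tr (f x)) @ F --> \tr A.
Proof.
by move=> /cvg_mxP fA; apply: (cvg_big add_continuous) => i _; exact: fA.
Qed.

Lemma cvg_det p (f : T -> 'M[R]_p) (A : 'M[R]_p) :
  f @ F --> A -> (fun x => \det (f x)) @ F --> \det A.
Proof.
move=> /cvg_mxP fA; rewrite /determinant.
apply: (cvg_big add_continuous) => s _; apply: cvgM; first exact: cvg_cst.
by apply: (cvg_big mul_continuous) => i _; exact: fA.
Qed.

Lemma cvg_invmx p (f : T -> 'M[R]_p) (A : 'M[R]_p) : A \in unitmx ->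
  f @ F --> A -> (fun x => invmx (f x)) @ F --> invmx A.
Proof.
move=> Au fA; have dA : \det A != 0 by rewrite -unitfE -unitmxE.
have h : (fun x => (\det (f x))^-1 *: \adj (f x)) @ F --> (\det A)^-1 *: \adj A.
  apply/cvg_mxP => i j; under eq_fun do rewrite !mxE; rewrite !mxE.
  apply: cvgM; first by apply: cvgV => //; exact: cvg_det.
  apply: cvgM; first exact: cvg_cst.
  apply: cvg_det; apply/cvg_mxP => a b; under eq_fun do rewrite !mxE.
  by rewrite !mxE; exact: (cvg_mxP _ _).1 fA _ _.
rewrite {2}/invmx Au; apply: cvg_trans h; apply: near_eq_cvg.
have : \forall x \near F, \det (f x) != 0.
  by apply: (cvgr_neq0 _ (cvg_det fA)).
by apply: filterS => x; rewrite -unitfE -unitmxE /invmx => ->.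
Qed.

Lemma cvg_mxvec p q (f : T -> 'M[R]_(p, q)) (A : 'M[R]_(p, q)) :
  f @ F --> A -> (fun x => mxvec (f x)) @ F --> mxvec A.
Proof.
move=> /cvg_mxP fA; apply/cvg_mxP => i j; rewrite (ord1 i).
case/mxvec_indexP: j => a b; under eq_fun do rewrite mxvecE.
by rewrite mxvecE; exact: fA.
Qed.

Lemma cvg_vec_mx p q (f : T -> 'rV[R]_(p * q)) (A : 'rV[R]_(p * q)) :
  f @ F --> A -> (fun x => vec_mx (f x)) @ F --> vec_mx A.
Proof.
move=> /cvg_mxP fA; apply/cvg_mxP => i j.
by under eq_fun do rewrite mxE; rewrite mxE; exact: fA.
Qed.

End MatrixLimits.

Section Sylvester.
Context {R : realType} {p : nat}.
Implicit Types A B X : 'M[R]_p.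

(** The matrix of the Sylvester operator X |-> A X + X B. *)
Definition sylvester_mx A B : 'M[R]_(p * p) := lin_mulmx A + lin_mulmxr B.

Lemma mul_sylvester_mx A B X : mxvec X *m sylvester_mx A B = mxvec (A *m X + X *m B).
Proof. by rewrite mulmxDr !mul_vec_lin linearD. Qed.

Lemma sylvester_mx_unit A B : spd A -> spd B -> sylvester_mx A B \in unitmx.
Proof.
move=> sA sB; rewrite unitmxE unitfE; apply/negP => /det0P[v v0].
rewrite -(vec_mxK v) mul_sylvester_mx -[RHS](linear0 mxvec).
move=> /(can_inj mxvecK)/(spd_sylvester sA sB) v0'.
by move: v0; rewrite -(vec_mxK v) v0' linear0 eqxx.
Qed.

(** In this form the entries are seen to be polynomials in those of A and B, and
    to converge with them. *)
Lemma sylvester_mx_entry A B i j : sylvester_mx A B i j =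
  \sum_a \sum_b (A a b * lin_mulmx (delta_mx a b) i j
                 + B a b * lin_mulmxr (delta_mx a b) i j).
Proof.
rewrite mxE {1}[A]matrix_sum_delta {1}[B]matrix_sum_delta.
rewrite !linear_sum /= !summxE -big_split /=; apply: eq_bigr => a _.
rewrite !linear_sum /= !summxE -big_split /=; apply: eq_bigr => b _.
by rewrite !linearZ /= !mxE.
Qed.

Lemma cvg_sylvester_mx {T : Type} {F : set_system T} {FF : Filter F}
  (f g : T -> 'M[R]_p) A B :
  f @ F --> A -> g @ F --> B ->
  (fun x => sylvester_mx (f x) (g x)) @ F --> sylvester_mx A B.
Proof.
move=> /cvg_mxP fA /cvg_mxP gB; apply/cvg_mxP => i j; rewrite sylvester_mx_entry.
under eq_fun do rewrite sylvester_mx_entry.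
apply: (cvg_big add_continuous) => a _; apply: (cvg_big add_continuous) => b _.
by apply: cvgD; apply: cvgM => //; exact: cvg_cst.
Qed.

Lemma sub_sqrE A B : A *m A - B *m B = A *m (A - B) + (A - B) *m B.
Proof. by rewrite mulmxBr mulmxBl addrA subrK. Qed.

Definition sqnorm A := \tr (A^T *m A).

Lemma sqnormE A : sqnorm A = \sum_i \sum_j A i j ^+ 2.
Proof.
rewrite /sqnorm /mxtrace exchange_big; apply: eq_bigr => j _.
by rewrite mxE; apply: eq_bigr => i _; rewrite mxE expr2.
Qed.

Lemma sqnorm_ge0 A : 0 <= sqnorm A.
Proof. by rewrite sqnormE; do 2!apply: sumr_ge0 => ? _; exact: sqr_ge0. Qed.

Lemma sqnorm_entry A i j : A i j ^+ 2 <= sqnorm A.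
Proof.
rewrite sqnormE (bigD1 i)//= (bigD1 j)//= -addrA lerDl.
by rewrite addr_ge0// sumr_ge0// => *; rewrite ?sumr_ge0// => *; exact: sqr_ge0.
Qed.

Lemma sqnormB A B : sqnorm (A - B) = sqnorm A - 2 * \tr (A^T *m B) + sqnorm B.
Proof.
rewrite /sqnorm [(A - B)^T]linearB /= mulmxBl !mulmxBr.
have tB X Y : \tr (X - Y) = \tr X - \tr Y by exact: linearB.
rewrite !tB -[\tr (B^T *m A)]mxtrace_tr trmx_mul trmxK; ring.
Qed.

(** With X = A - B and E = A^2 - B^2 = A X + X B, the scalar product of X C and
    E C^-1 is tr (X^T E) >= tr (X^T X B) = |X C|^2. The bound involves A only
    through E, so that A^2 --> B^2 implies A --> B. *)
Lemma sqrt_estimate A B C : spd A -> spd B -> C^T = C -> C \in unitmx ->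
  C *m C = B ->
  sqnorm ((A - B) *m C) <= sqnorm ((A *m A - B *m B) *m invmx C).
Proof.
move=> sA sB CT Cu CC; rewrite sub_sqrE; set X := A - B; set E := _ + _.
have h1 : sqnorm (X *m C) <= \tr (X^T *m E).
  rewrite /E mulmxDr mxtraceD mulmxA -[leLHS]add0r lerD// ?trace_spd_ge0//.
  by rewrite /sqnorm trmx_mul CT -mulmxA mxtrace_mulC -CC !mulmxA.
have h2 : \tr ((X *m C)^T *m (E *m invmx C)) = \tr (X^T *m E).
  by rewrite trmx_mul CT -mulmxA mxtrace_mulC !mulmxA mulmxKV// .
have := sqnorm_ge0 (X *m C - E *m invmx C); rewrite sqnormB h2; lra.
Qed.

End Sylvester.

Section SmoothSqrt.
Context {R : realType} {m p : nat} (V : set 'cV[R]_m) (oV : relatively_open V).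
Implicit Types (y : 'cV[R]_m) (k : 'I_m) (A S : 'cV[R]_m -> 'M[R]_p).

Lemma spd_sqrt_continuous A S : (forall y, V y -> spd (S y)) ->
  (forall y, V y -> S y *m S y = A y) ->
  {within V, continuous A} -> {within V, continuous S}.
Proof.
move=> sS SA /subspace_continuousP cA; apply/subspace_continuousP => y Vy.
rewrite /from_subspace.
have [sC CC] := sqrtmxP (sS y Vy); move: (sqrtmx _) sC CC => C sC CC.
have Cu := spd_unit sC.
have F0 : (fun z => sqnorm ((A z - A y) *m invmx C)) @ within V (nbhs y) --> (0 : R).
  have -> : 0 = sqnorm ((A y - A y) *m invmx C) by rewrite subrr mul0mx /sqnorm mulmx0 mxtrace0.
  have h : (fun z => (A z - A y) *m invmx C) @ within V (nbhs y) --> (A y - A y) *m invmx C.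
    apply: cvg_mulmx; last exact: cvg_cst.
    by apply: cvgB; [exact: cA|exact: cvg_cst].
  by apply: cvg_mxtrace; apply: cvg_mulmx => //; exact: cvg_trmx.
have XC : (fun z => (S z - S y) *m C) @ within V (nbhs y) --> (0 : 'M[R]_p).
  apply/cvg_mxP => i j; rewrite mxE; apply/cvgrPdist_lt => e e0.
  have /cvgr_lt/(_ (e ^+ 2)) := F0; rewrite exprn_gt0// => /(_ isT).
  move=> h1; apply: (@filterS _ (nbhs y) _ _ _ _ h1) => z h Vz.
  rewrite sub0r normrN -(ltr_pXn2r (n := 2)) ?nnegrE ?(ltW e0)// real_normK ?num_real//.
  apply: le_lt_trans (sqnorm_entry _ _ _) _; apply: le_lt_trans (h Vz).
  have := sqrt_estimate (sS z Vz) (sS y Vy) sC.1 Cu CC.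
  by rewrite !SA.
have h : (fun z => (S z - S y) *m C *m invmx C + S y) @
    within V (nbhs y) --> 0 *m invmx C + S y.
  by apply: cvgD; [apply: cvg_mulmx => //; exact: cvg_cst|exact: cvg_cst].
rewrite mul0mx add0r in h; apply: cvg_trans h; apply: near_eq_cvg.
by apply: (@filterE _ (within V (nbhs y))) => z; rewrite mulmxK// subrK.
Qed.

(** The difference quotients X of S and Y of A satisfy the Sylvester equation
    S(y + t e_k) X + X S(y) = Y, whose operator converges to an invertible
    one. *)
Lemma sqrt_diff_quotient A S k y (a : 'M[R]_p) : (forall y, V y -> spd (S y)) ->
  (forall y, V y -> S y *m S y = A y) ->
  {within V, continuous S} -> V y ->
  diff_quotient k A y @ increments k y --> a ->
  diff_quotient k S y @ increments k y -->
    vec_mx (mxvec a *m invmx (sylvester_mx (S y) (S y))).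
Proof.
move=> sS SA cS Vy Aa; have ? := increments_proper k (relatively_open_halfspace oV Vy).
have nV := increments_near k oV Vy.
have cy : (fun t : R => y + t *: (delta_mx k 0 : 'cV[R]_m)) @ increments k y --> y.
  rewrite -[X in _ --> X]addr0 -(scale0r (delta_mx k 0)).
  by apply: cvgD; [exact: cvg_cst|apply: cvgZr_tmp; exact: increments_cvg0].
have Sc : (fun t => S (y + t *: delta_mx k 0)) @ increments k y --> S y.
  move=> B SB; have h := (subspace_continuousP _ _).1 cS y Vy B SB.
  have := cy _ h; rewrite /= /fmap /=.
  by move: nV; apply: filterS2 => t Vt; exact.
have h : (fun t => vec_mx (mxvec (diff_quotient k A y t) *m
     invmx (sylvester_mx (S (y + t *: delta_mx k 0)) (S y)))) @ increments k y -->
   vec_mx (mxvec a *m invmx (sylvester_mx (S y) (S y))).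
  apply: cvg_vec_mx; apply: cvg_mulmx; first exact: cvg_mxvec.
  apply: cvg_invmx; first by apply: sylvester_mx_unit; exact: sS.
  by apply: cvg_sylvester_mx => //; exact: cvg_cst.
apply: cvg_trans h; apply: near_eq_cvg; move: nV; apply: filterS => t Vt.
rewrite /diff_quotient -!SA// sub_sqrE linearZ /= -scalemxAl -mul_sylvester_mx.
by rewrite mulmxK ?sylvester_mx_unit ?linearZ /= ?mxvecK//; exact: sS.
Qed.

(** The partial derivatives of S are polynomials in those of A, in the entries of
    S, and in the inverse of the determinant of the Sylvester operator, which is
    itself the inverse of a polynomial in the entries of S: these functions form
    a class as in algebra_span_smooth. *)
Lemma smooth_on_sqrt A S : (forall y, V y -> spd (S y)) ->
  (forall y, V y -> S y *m S y = A y) ->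
  smooth_on V A -> smooth_on V S.
Proof.
move=> sS SA sA; have cS := spd_sqrt_continuous sS SA (smooth_on_continuous sA).
pose D y := sylvester_mx (S y) (S y).
have Du y : V y -> D y \in unitmx by move=> Vy; apply: sylvester_mx_unit; exact: sS.
pose P (g : 'cV[R]_m -> R^o) := exists i j, g = fun y => S y i j.
pose Q (g : 'cV[R]_m -> R^o) := [\/ smooth_on V g, P g | g = fun y => (\det (D y))^-1].
have PD i j : algebra_span P (fun y => D y i j).
  under eq_fun do rewrite sylvester_mx_entry.
  apply: algebra_span_sum => a _; apply: algebra_span_sum => b _.
  have Sab : algebra_span P (fun y => S y a b) by apply: algebra_span_gen; exists a, b.
  by apply: algebra_spanD; apply: algebra_spanM => //; exact: algebra_span_cst.
have PQ g : P g -> Q g by move=> Pg; apply: Or32.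
have [|B QB BD] := algebra_span_invmx Du _ (Or33 _ _ erefl : Q _).
  by move=> i j; exact: algebra_span_sub (PD i j).
have dP g : P g -> differentiable_into V Q g.
  move=> [i [j ->]]; split.
    apply/subspace_continuousP => y Vy.
    exact: (cvg_mxP _ _).1 ((subspace_continuousP _ _).1 cS y Vy) i j.
  move=> k; exists (fun y => (mxvec (pderiv k A y) *m B y) 0 (mxvec_index i j)).
    under eq_fun do rewrite mxE; apply: algebra_span_sum => l _.
    apply: algebra_spanM; last exact: QB.
    case/mxvec_indexP: l => a b; under eq_fun do rewrite mxvecE.
    apply: algebra_span_gen; apply: Or31; apply: (smooth_on_mxP oV _).1.
    exact: smooth_on_pderiv.
  move=> y Vy; have := sqrt_diff_quotient (k := k) sS SA cS Vy (smooth_on_cvg sA Vy).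
  by move=> /(diff_quotient_mx_cvg oV _ _ _ Vy)/(_ i j); rewrite mxE BD.
apply/(smooth_on_mxP oV) => i j; apply: (algebra_span_smooth oV (Q := Q)); last first.
  by apply: algebra_span_gen; apply: PQ; exists i, j.
move=> g [sg|/dP//|->].
  by apply: smooth_on_differentiable => // ?; exact: Or31.
apply: (inv_differentiable oV); last exact: Or33.
  by move=> y /Du; rewrite unitmxE unitfE.
by apply: (algebra_span_differentiable oV PQ dP); exact: algebra_span_det.
Qed.

(** By uniqueness S coincides on V with the explicit formula for the mean, which
    is built from square roots and inverses. *)
Lemma smooth_on_geometric_mean (A B S : 'cV[R]_m -> 'M[R]_p) :
  (forall y, V y -> spd (A y)) -> (forall y, V y -> spd (B y)) ->
  (forall y, V y -> spd (S y)) ->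
  (forall y, V y -> S y *m invmx (A y) *m S y = B y) ->
  smooth_on V A -> smooth_on V B -> smooth_on V S.
Proof.
move=> pA pB pS SAB sA sB.
have rP y : V y -> spd (sqrtmx (A y)) /\ sqrtmx (A y) *m sqrtmx (A y) = A y.
  by move=> Vy; apply: sqrtmxP; exact: pA.
have sr : smooth_on V (fun y => sqrtmx (A y)).
  by apply: smooth_on_sqrt sA => y Vy; have [] := rP y Vy.
have si : smooth_on V (fun y => invmx (sqrtmx (A y))).
  by apply: (smooth_on_invmx oV) => // y Vy; apply: spd_unit; have [] := rP y Vy.
have sT : smooth_on V (fun y => sqrtmx (invmx (sqrtmx (A y)) *m B y *m invmx (sqrtmx (A y)))).
  apply: (smooth_on_sqrt (A := fun y => invmx (sqrtmx (A y)) *m B y *m invmx (sqrtmx (A y)))).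
  - move=> y Vy; apply: (sqrtmxP _).1; apply: spd_conj_sym; first exact: pB.
    by apply: spd_inv; have [] := rP y Vy.
  - move=> y Vy; apply: (sqrtmxP _).2; apply: spd_conj_sym; first exact: pB.
    by apply: spd_inv; have [] := rP y Vy.
  - exact: (smooth_on_mulmx oV (smooth_on_mulmx oV si sB) si).
have sm : smooth_on V (fun y => geometric_mean (A y) (B y)).
  exact: (smooth_on_mulmx oV (smooth_on_mulmx oV sr sT) sr).
apply: (smooth_on_eq oV _ sm) => y Vy; have [sM ME] := geometric_meanP (pA y Vy) (pB y Vy).
by apply: (geometric_mean_unique (pA y Vy)) => //; [exact: pS|rewrite ME SAB].
Qed.

End SmoothSqrt.

(** * Convergence of all derivatives on compact sets *)

Lemma initial_cvgP (S : choiceType) (T : topologicalType) (f : S -> T)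
    (F : set_system S) (s : S) : Filter F ->
  (F --> (s : initial_topology f)) <-> (f @ F --> f s).
Proof.
move=> FF; split=> [Fs A /= nA|Fs A].
  exact/Fs/initial_continuous.
rewrite nbhsE => -[B [[C oC <-] Cs] BA].
apply: filterS BA _; apply: Fs; exact: open_nbhs_nbhs.
Qed.

Lemma family_cvgP (U : choiceType) (R : realType) (W : normedModType R)
    (fam : set (set U)) (F : set_system (U -> W)) (f : U -> W) : Filter F ->
  {family fam, F --> f} <-> (forall A, fam A -> forall e : R, 0 < e ->
    \forall g \near F, forall x, A x -> `|g x - f x| <= e).
Proof.
move=> FF; rewrite fam_cvgP; split=> h A famA.
  move=> e e0; apply: (h A famA); apply/uniform_nbhs.
  exists [set xy | `|xy.2 - xy.1| <= e]; split.
    rewrite -entourage_ballE; exists e => // -[x y] /=.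
    rewrite -ball_normE /= => xy; rewrite -normrN opprB; exact: ltW.
  by move=> g gA x Ax; exact: gA.
move=> P /uniform_nbhs[E [entE EP]].
move: entE; rewrite -entourage_ballE => -[e /= e0 eE].
have e20 : 0 < e / 2 by rewrite divr_gt0.
apply: filterS (h A famA _ e20) => g gA; apply: EP => x Ax.
apply: eE => /=; rewrite -ball_normE /= -normrN opprB.
by apply: le_lt_trans (gA x Ax) _; rewrite ltr_pdivrMr// ltr_pMr// ltr1n.
Qed.

Section JetConvergence.
Context {R : realType} {m : nat} (V : set 'cV[R]_m) (oV : relatively_open V).
Context {T : Type} {F : set_system T} {FF : Filter F}.
Implicit Types (K : set 'cV[R]_m) (w : seq 'I_m).

(** V stands for a chart image: with jet_cvg for every chart, this is convergence
    in the Fréchet topology. *)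
Definition jet_cvg_at {W : normedModType R} w (f : T -> 'cV[R]_m -> W) (g : 'cV[R]_m -> W) :=
  forall K, compact K -> K `<=` V -> forall e, 0 < e ->
  \forall t \near F, forall y, K y -> `|pderivs w (f t) y - pderivs w g y| <= e.

Definition jet_cvg {W : normedModType R} (f : T -> 'cV[R]_m -> W) (g : 'cV[R]_m -> W) :=
  forall w, jet_cvg_at w f g.

Lemma jet_cvg_at_eq {W : normedModType R} w (f f' : T -> 'cV[R]_m -> W) g g' :
  (forall t y, V y -> f t y = f' t y) -> (forall y, V y -> g y = g' y) ->
  jet_cvg_at w f g -> jet_cvg_at w f' g'.
Proof.
move=> ff gg fg K cK KV e e0; apply: filterS (fg K cK KV e e0) => t ft y Ky.
by rewrite -(pderivs_eq oV w (ff t) (KV y Ky)) -(pderivs_eq oV w gg (KV y Ky)) ft.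
Qed.

Lemma jet_cvg_at_rcons {W : normedModType R} w k (f : T -> 'cV[R]_m -> W) g :
  jet_cvg_at (rcons w k) f g <->
  jet_cvg_at w (fun t => pderiv k (f t)) (pderiv k g).
Proof.
split=> h K cK KV e e0; apply: filterS (h K cK KV e e0) => t ht y Ky.
  by rewrite -!pderivs_rcons; exact: ht.
by rewrite !pderivs_rcons; exact: ht.
Qed.

Lemma jet_cvg_cst {W : normedModType R} (g : 'cV[R]_m -> W) : jet_cvg (fun=> g) g.
Proof.
move=> w K cK KV e e0; apply: filterE => t y Ky.
by rewrite subrr normr0 ltW.
Qed.

Lemma compact_bounded_on {W : normedModType R} (f : 'cV[R]_m -> W) K :
  {within V, continuous f} -> compact K -> K `<=` V ->
  exists2 C, 0 < C & forall y, K y -> `|f y| <= C.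
Proof.
move=> cf cK KV; have cfK : {within K, continuous f} := continuous_subspaceW KV cf.
have [C [_ HC]] := compact_bounded (continuous_compact cfK cK).
exists (`|C| + 1); first by rewrite ltr_wpDl.
move=> y Ky; apply: (HC (`|C| + 1)); last by exists y.
by rewrite (le_lt_trans (ler_norm C))// ltrDl.
Qed.

Lemma jet_cvg_mxP p q (f : T -> 'cV[R]_m -> 'M[R]_(p, q)) (g : 'cV[R]_m -> 'M[R]_(p, q)) :
  (forall t, smooth_on V (f t)) -> smooth_on V g ->
  jet_cvg f g <-> forall i j, jet_cvg (fun t y => f t y i j : R^o) (fun y => g y i j : R^o).
Proof.
move=> sf sg.
have E t y i j w : V y ->
    pderivs w (fun y => f t y i j : R^o) y - pderivs w (fun y => g y i j : R^o) y
    = (pderivs w (f t) y - pderivs w g y) i j.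
  by move=> Vy; rewrite -(pderivs_mxE oV w i j (sf t) Vy) -(pderivs_mxE oV w i j sg Vy) !mxE.
split=> [fg i j w K cK KV e e0|fg w K cK KV e e0].
  apply: filterS (fg w K cK KV e e0) => t h y Ky.
  by rewrite E; [move: (h y Ky) => /(mx_norm_leP _ (ltW e0))|exact: KV].
have : \forall t \near F, forall i j, forall y, K y ->
    `|pderivs w (fun y => f t y i j : R^o) y - pderivs w (fun y => g y i j : R^o) y| <= e.
  apply: filter_forall => i; apply: filter_forall => j; exact: fg.
apply: filterS => t h y Ky; apply/mx_norm_leP; first exact: ltW.
by move=> i j; rewrite -E; [exact: h|exact: KV].
Qed.

Lemma jet_cvg_atD {W : normedModType R} w (f f' : T -> 'cV[R]_m -> W) g g' :
  (forall t, smooth_on V (f t)) -> smooth_on V g ->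
  (forall t, smooth_on V (f' t)) -> smooth_on V g' ->
  jet_cvg_at w f g -> jet_cvg_at w f' g' ->
  jet_cvg_at w (fun t => f t \+ f' t) (g \+ g').
Proof.
move=> sf sg sf' sg' fg fg' K cK KV e e0.
have e20 : 0 < e / 2 by rewrite divr_gt0.
apply: filterS2 (fg K cK KV _ e20) (fg' K cK KV _ e20) => t h h' y Ky.
rewrite (pderivsD oV w (sf t) (sf' t) (KV y Ky)) (pderivsD oV w sg sg' (KV y Ky)).
rewrite opprD addrACA (le_trans (ler_normD _ _))// [leRHS](splitr e).
by rewrite lerD ?h ?h'.
Qed.

(** Induction on the word w by the Leibniz rule. The last letter is the one that
    is peeled off, since it is the derivative that is applied first. *)
Lemma jet_cvg_atM w (f f' : T -> 'cV[R]_m -> R^o) g g' :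
  (forall t, smooth_on V (f t)) -> smooth_on V g ->
  (forall t, smooth_on V (f' t)) -> smooth_on V g' ->
  jet_cvg f g -> jet_cvg f' g' ->
  jet_cvg_at w (fun t y => f t y * f' t y) (fun y => g y * g' y).
Proof.
elim/last_ind: w f f' g g' => [|w k IH] f f' g g' sf sg sf' sg' fg fg'.
  move=> K cK KV e e0 /=.
  have [C C0 HC] := compact_bounded_on (smooth_on_continuous sg) cK KV.
  have [C' C'0 HC'] := compact_bounded_on (smooth_on_continuous sg') cK KV.
  have d10 : 0 < Num.min 1 (e / 2 / C) by rewrite lt_min ltr01 !divr_gt0.
  have d20 : 0 < e / 2 / (C' + 1) by rewrite !divr_gt0// addr_gt0.
  apply: filterS2 (fg [::] K cK KV _ d20) (fg' [::] K cK KV _ d10) => t h h' y Ky.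
  have {}h := h y Ky; have {}h' := h' y Ky; rewrite /= in h h'.
  move: h'; rewrite le_min => /andP[h1 h2].
  have -> : f t y * f' t y - g y * g' y = (f t y - g y) * f' t y + g y * (f' t y - g' y).
    by rewrite mulrBl mulrBr addrA subrK.
  rewrite (le_trans (ler_normD _ _))// !normrM [leRHS](splitr e) lerD//.
    (* The minimum with 1 in the bound for f' - g' serves here. *)
    have h3 : `|f' t y| <= C' + 1.
      rewrite -(subrK (g' y) (f' t y)) (le_trans (ler_normD _ _))// addrC.
      by rewrite lerD// HC'.
    apply: (le_trans (ler_pM _ _ h h3)) => //.
    by rewrite divfK// gt_eqF// addr_gt0.
  apply: (le_trans (ler_pM _ _ (HC _ Ky) h2)) => //.
  by rewrite mulrC divfK// gt_eqF.
have L (u v : 'cV[R]_m -> R^o) : smooth_on V u -> smooth_on V v -> forall y, V y ->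
    pderiv k u y * v y + u y * pderiv k v y = pderiv k (fun y => u y * v y) y.
  move=> su sv y Vy; symmetry; rewrite addrC; apply: (pderiv_cvg oV Vy).
  exact: (diff_quotientM_cvg oV Vy (smooth_on_cvg su Vy) (smooth_on_cvg sv Vy)).
have dfg (u : T -> 'cV[R]_m -> R^o) v :
    jet_cvg u v -> jet_cvg (fun t => pderiv k (u t)) (pderiv k v).
  by move=> uv w'; apply/jet_cvg_at_rcons.
apply/jet_cvg_at_rcons; apply: jet_cvg_at_eq (fun t => L _ _ (sf t) (sf' t)) (L _ _ sg sg') _.
have sp (u : 'cV[R]_m -> R^o) : smooth_on V u -> smooth_on V (pderiv k u).
  exact: smooth_on_pderiv.
apply: (@jet_cvg_atD R^o w (fun t y => pderiv k (f t) y * f' t y)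
  (fun t y => f t y * pderiv k (f' t) y) (fun y => pderiv k g y * g' y)
  (fun y => g y * pderiv k g' y)).
- by move=> t; exact: (smooth_onM oV (sp _ (sf t)) (sf' t)).
- exact: (smooth_onM oV (sp _ sg) sg').
- by move=> t; exact: (smooth_onM oV (sf t) (sp _ (sf' t))).
- exact: (smooth_onM oV sg (sp _ sg')).
- exact: (IH _ _ _ _ (fun t => sp _ (sf t)) (sp _ sg) sf' sg' (dfg _ _ fg) fg').
- exact: (IH _ _ _ _ sf sg (fun t => sp _ (sf' t)) (sp _ sg') fg (dfg _ _ fg')).
Qed.

Lemma jet_cvgM (f f' : T -> 'cV[R]_m -> R^o) g g' :
  (forall t, smooth_on V (f t)) -> smooth_on V g ->
  (forall t, smooth_on V (f' t)) -> smooth_on V g' ->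
  jet_cvg f g -> jet_cvg f' g' ->
  jet_cvg (fun t y => f t y * f' t y) (fun y => g y * g' y).
Proof. by move=> *; move=> w; exact: jet_cvg_atM. Qed.

Lemma jet_cvg_sum (I : Type) (r : seq I) (f : I -> T -> 'cV[R]_m -> R^o) g :
  (forall i t, smooth_on V (f i t)) -> (forall i, smooth_on V (g i)) ->
  (forall i, jet_cvg (f i) (g i)) ->
  jet_cvg (fun t y => \sum_(i <- r) f i t y) (fun y => \sum_(i <- r) g i y).
Proof.
move=> sf sg fg w.
have ss (h : I -> 'cV[R]_m -> R^o) s : (forall i, smooth_on V (h i)) ->
    smooth_on V (fun y => \sum_(i <- s) h i y : R^o).
  move=> sh; apply: (algebra_span_smooth_on oV); apply: algebra_span_sum => i _.
  exact: algebra_span_gen.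
elim: r => [|i r IH].
  have E (h : I -> 'cV[R]_m -> R^o) : (fun y => \sum_(i <- [::]) h i y) = fun=> 0.
    by apply/funext => y; rewrite big_nil.
  apply: (@jet_cvg_at_eq _ w (fun=> fun=> 0) _ (fun=> 0)).
  - by move=> t y _; rewrite big_nil.
  - by move=> y _; rewrite big_nil.
  - exact: jet_cvg_cst.
apply: (@jet_cvg_at_eq R^o w (fun t => f i t \+ (fun y => \sum_(i <- r) f i t y)) _
   (g i \+ (fun y => \sum_(i <- r) g i y))).
- by move=> t y _; rewrite big_cons.
- by move=> y _; rewrite big_cons.
- exact: (jet_cvg_atD (sf i) (sg i) (fun t => ss (f^~ t) r (fun i => sf i t))
    (ss _ r sg) (fg i w) IH).
Qed.

Lemma jet_cvg_mulmx p q r (f : T -> 'cV[R]_m -> 'M[R]_(p, q))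
    (f' : T -> 'cV[R]_m -> 'M[R]_(q, r)) g g' :
  (forall t, smooth_on V (f t)) -> smooth_on V g ->
  (forall t, smooth_on V (f' t)) -> smooth_on V g' ->
  jet_cvg f g -> jet_cvg f' g' ->
  jet_cvg (fun t y => f t y *m f' t y) (fun y => g y *m g' y).
Proof.
move=> sf sg sf' sg' fg fg'; apply/jet_cvg_mxP.
- by move=> t; exact: (smooth_on_mulmx oV (sf t) (sf' t)).
- exact: (smooth_on_mulmx oV sg sg').
move=> i j.
have {}fg := (jet_cvg_mxP sf sg).1 fg; have {}fg' := (jet_cvg_mxP sf' sg').1 fg'.
have {}sf l t := (smooth_on_mxP oV _).1 (sf t) i l.
have {}sg l := (smooth_on_mxP oV _).1 sg i l.
have {}sf' l t := (smooth_on_mxP oV _).1 (sf' t) l j.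
have {}sg' l := (smooth_on_mxP oV _).1 sg' l j.
move=> w; apply: (@jet_cvg_at_eq R^o w (fun t y => \sum_l f t y i l * f' t y l j) _
  (fun y => \sum_l g y i l * g' y l j)).
- by move=> t y _; rewrite mxE.
- by move=> y _; rewrite mxE.
apply: jet_cvg_sum => [l t|l|l].
- exact: (smooth_onM oV (sf l t) (sf' l t)).
- exact: (smooth_onM oV (sg l) (sg' l)).
- exact: (jet_cvgM (sf l) (sg l) (sf' l) (sg' l) (fg i l) (fg' l j)).
Qed.

Lemma jet_cvg_trmx p q (f : T -> 'cV[R]_m -> 'M[R]_(p, q)) g :
  (forall t, smooth_on V (f t)) -> smooth_on V g ->
  jet_cvg f g -> jet_cvg (fun t y => (f t y)^T) (fun y => (g y)^T).
Proof.
move=> sf sg /(jet_cvg_mxP sf sg) fg; apply/jet_cvg_mxP.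
- by move=> t; exact: (smooth_on_trmx oV (sf t)).
- exact: (smooth_on_trmx oV sg).
move=> i j w; apply: (jet_cvg_at_eq _ _ (fg j i w)).
- by move=> t y _; rewrite mxE.
- by move=> y _; rewrite mxE.
Qed.

Lemma jet_cvgD {W : normedModType R} (f f' : T -> 'cV[R]_m -> W) g g' :
  (forall t, smooth_on V (f t)) -> smooth_on V g ->
  (forall t, smooth_on V (f' t)) -> smooth_on V g' ->
  jet_cvg f g -> jet_cvg f' g' ->
  jet_cvg (fun t => f t \+ f' t) (g \+ g').
Proof. by move=> sf sg sf' sg' fg fg' w; exact: jet_cvg_atD. Qed.

Lemma jet_cvgZ {W : normedModType R} (c : T -> R) (d : R) (f : T -> 'cV[R]_m -> W) g :
  (forall t, smooth_on V (f t)) -> smooth_on V g ->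
  c @ F --> d -> jet_cvg f g -> jet_cvg (fun t => c t \*: f t) (d \*: g).
Proof.
move=> sf sg cd fg w K cK KV e e0.
have [C C0 HC] := compact_bounded_on (sg w).1 cK KV.
have d10 : 0 < e / 2 / (`|d| + 1) by rewrite !divr_gt0// ltr_wpDl.
have d20 : 0 < Num.min 1 (e / 2 / C) by rewrite lt_min ltr01 !divr_gt0.
move/cvgr_distC_le: cd => /(_ _ d20); apply: filterS2 (fg w K cK KV _ d10) => t h hc y Ky.
have {}h := h y Ky; move: hc; rewrite le_min => /andP[c1 c2].
rewrite (pderivsZ oV _ _ (sf t) (KV y Ky)) (pderivsZ oV _ _ sg (KV y Ky)).
set u := pderivs w (f t) y in h *; set v := pderivs w g y in h *.
have -> : c t *: u - d *: v = c t *: (u - v) + (c t - d) *: v.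
  by rewrite scalerBr scalerBl addrA subrK.
rewrite (le_trans (ler_normD _ _))// !normrZ [leRHS](splitr e) lerD//.
  have h3 : `|c t| <= `|d| + 1.
    by rewrite -(subrK d (c t)) (le_trans (ler_normD _ _))// addrC lerD.
  apply: (le_trans (ler_pM _ _ h3 h)) => //.
  by rewrite mulrC divfK// gt_eqF// ltr_wpDl.
apply: (le_trans (ler_pM _ _ c2 (HC _ Ky))) => //.
by rewrite divfK// gt_eqF.
Qed.

End JetConvergence.

(** * The spaces of one-forms and of symmetric tensor fields *)

Section FrechetSpaces.
Context {R : realType} {m : nat} (M : manifold R m).
Implicit Types (i : atlas M) (x : M).

Lemma form_smooth n (a : one_form M n) i : smooth_on (chart_image i) (form_in_chart i a).
Proof. by have /asboolP := valP a. Qed.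

Lemma tensor_smooth (h : sym_tensor M) i : smooth_on (chart_image i) (tensor_in_chart i h).
Proof. by have /asboolP[] := valP h. Qed.

Lemma tensor_sym (h : sym_tensor M) x : (h x)^T = h x.
Proof. by have /asboolP[_ ->] := valP h. Qed.

Lemma jet_family_cvgP {W : normedModType R} {T : Type} {F : set_system T} {FF : Filter F}
    (f : T -> atlas M -> 'cV[R]_m -> W) (f0 : atlas M -> 'cV[R]_m -> W) :
  (fun t => jet (f t) : {family @jet_compacts R m M, _ -> W}) @ F -->
    (jet f0 : {family @jet_compacts R m M, _ -> W}) <->
  forall i, jet_cvg (chart_image i) (F := F) (fun t => f t i) (f0 i).
Proof.
rewrite family_cvgP; split=> [h i w K cK KV e e0|h A [i [w [K [cK KV ->]]]] e e0].
  have : @jet_compacts R m M [set p : atlas M * seq 'I_m * 'cV[R]_m | p.1 = (i, w) /\ K p.2].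
    by exists i, w, K.
  move=> /h/(_ e e0) hF; apply: (@filterS T F FF _ _ _ hF) => t ht y Ky.
  by have := ht (i, w, y); apply.
apply: (@filterS T F FF _ _ _ (h i w K cK KV e e0)) => t ht [[i' w'] y] /=.
by move=> [[-> ->] Ky]; exact: ht.
Qed.

Lemma one_form_cvgP n {T : Type} {F : set_system T} {FF : Filter F}
    (g : T -> one_form M n) (a : one_form M n) :
  g @ F --> a <->
  forall i, jet_cvg (chart_image i) (F := F)
    (fun t => form_in_chart i (g t)) (form_in_chart i a).
Proof.
rewrite -(jet_family_cvgP (fun t i => form_in_chart i (g t)) (fun i => form_in_chart i a)).
exact: (@initial_cvgP _ _ (fun a : one_form M n => jet (fun i => form_in_chart i a)
     : {family @jet_compacts R m M, _ -> 'M[R]_(n, m)}) (g @ F) a).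
Qed.

Lemma sym_tensor_cvgP {T : Type} {F : set_system T} {FF : Filter F}
    (g : T -> sym_tensor M) (h : sym_tensor M) :
  g @ F --> h <->
  forall i, jet_cvg (chart_image i) (F := F)
    (fun t => tensor_in_chart i (g t)) (tensor_in_chart i h).
Proof.
rewrite -(jet_family_cvgP (fun t i => tensor_in_chart i (g t)) (fun i => tensor_in_chart i h)).
exact: (@initial_cvgP _ _ (fun h : sym_tensor M => jet (fun i => tensor_in_chart i h)
     : {family @jet_compacts R m M, _ -> 'M[R]_m}) (g @ F) h).
Qed.

Lemma one_form_linE n (c : R) (a b : one_form M n) x : (c *: a + b) x = c *: a x + b x.
Proof. by []. Qed.

Lemma one_formD n (a b : one_form M n) x : (a + b) x = a x + b x.
Proof. by []. Qed.

Lemma one_formZ n c (a : one_form M n) x : (c *: a) x = c *: a x.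
Proof. by []. Qed.

Lemma sym_tensorD (a b : sym_tensor M) x : (a + b) x = a x + b x.
Proof. by []. Qed.

Lemma sym_tensorZ c (a : sym_tensor M) x : (c *: a) x = c *: a x.
Proof. by []. Qed.

Lemma one_form_eq n (a b : one_form M n) : (forall x, a x = b x) -> a = b.
Proof. by move=> ab; apply: val_inj; exact/funext. Qed.

Lemma sym_tensor_eq (a b : sym_tensor M) : (forall x, a x = b x) -> a = b.
Proof. by move=> ab; apply: val_inj; exact/funext. Qed.

Lemma tensor_in_chartD i (a b : sym_tensor M) :
  tensor_in_chart i (a + b) = tensor_in_chart i a \+ tensor_in_chart i b.
Proof. by apply/funext => y; rewrite /tensor_in_chart /= mulmxDr mulmxDl. Qed.

Lemma tensor_in_chartZ i c (a : sym_tensor M) :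
  tensor_in_chart i (c *: a) = c \*: tensor_in_chart i a.
Proof. by apply/funext => y; rewrite /tensor_in_chart /= -scalemxAr -scalemxAl. Qed.

End FrechetSpaces.

(** * The pullback of the Euclidean scalar product as a quadratic map *)

Section SymmetricProduct.
Context {R : realType} {m n : nat} (M : manifold R m).
Implicit Types (i : atlas M) (x : M) (a b : one_form M n).

(** The polarization of the quadratic map a |-> a^T a. *)
Definition sym_product_fun a b x : 'M[R]_m :=
  2^-1 *: ((a x)^T *m b x + (b x)^T *m a x).

Lemma sym_product_in_chart a b i : tensor_in_chart i (sym_product_fun a b) =
  2^-1 \*: ((fun y => (form_in_chart i a y)^T *m form_in_chart i b y) \+
            (fun y => (form_in_chart i b y)^T *m form_in_chart i a y)).
Proof.
apply/funext => y; rewrite /tensor_in_chart /sym_product_fun /form_in_chart /=.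
by rewrite !trmx_mul -scalemxAr -scalemxAl mulmxDr mulmxDl !mulmxA.
Qed.

Lemma smooth_on_sym_product (f g : 'cV[R]_m -> 'M[R]_(n, m)) V : relatively_open V ->
  smooth_on V f -> smooth_on V g ->
  smooth_on V (2^-1 \*: ((fun y => (f y)^T *m g y) \+ (fun y => (g y)^T *m f y))).
Proof.
move=> oV sf sg; apply: (smooth_onZ oV); apply: (smooth_onD oV).
  exact: (smooth_on_mulTmx oV sf sg).
exact: (smooth_on_mulTmx oV sg sf).
Qed.

Lemma sym_product_smooth a b : sym_product_fun a b \in smooth_sym_tensor M.
Proof.
apply/asboolP; split=> [i|x].
  rewrite sym_product_in_chart.
  by apply: smooth_on_sym_product; [exact: chart_open|exact: form_smooth..].
by rewrite /sym_product_fun linearZ linearD /= !trmx_mul !trmxK addrC.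
Qed.

Definition sym_product a b : sym_tensor M := SymTensor (sym_product_smooth a b).

Lemma sym_productE a b x : sym_product a b x = 2^-1 *: ((a x)^T *m b x + (b x)^T *m a x).
Proof. by []. Qed.

Lemma pullback_metricE a : pullback_metric a = sym_product a a.
Proof.
apply: sym_tensor_eq => x; rewrite sym_productE; set B := _ *m _.
have -> : B + B = 2 *: B by rewrite scaler_nat mulr2n.
by rewrite scalerA mulVf ?scale1r// pnatr_eq0.
Qed.

Lemma sym_productDl a a' b : sym_product (a + a') b = sym_product a b + sym_product a' b.
Proof.
apply: sym_tensor_eq => x; rewrite sym_tensorD !sym_productE one_formD.
by rewrite -scalerDr [(a x + _)^T]linearD /= mulmxDl mulmxDr addrACA.
Qed.

Lemma sym_productZl c a b : sym_product (c *: a) b = c *: sym_product a b.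
Proof.
apply: sym_tensor_eq => x; rewrite sym_tensorZ !sym_productE one_formZ.
by rewrite [(c *: _)^T]linearZ /= -scalemxAl -scalemxAr -scalerDr !scalerA mulrC.
Qed.

Lemma sym_productC a b : sym_product a b = sym_product b a.
Proof. by apply: sym_tensor_eq => x; rewrite !sym_productE addrC. Qed.

Lemma sym_productDr a b b' : sym_product a (b + b') = sym_product a b + sym_product a b'.
Proof. by rewrite sym_productC sym_productDl !(sym_productC a). Qed.

Lemma sym_productZr c a b : sym_product a (c *: b) = c *: sym_product a b.
Proof. by rewrite sym_productC sym_productZl (sym_productC a). Qed.

Lemma sym_product_cvg {T : Type} {F : set_system T} {FF : Filter F}
    (f g : T -> one_form M n) a b :
  f @ F --> a -> g @ F --> b ->
  (fun t => sym_product (f t) (g t)) @ F --> sym_product a b.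
Proof.
move=> /one_form_cvgP fa /one_form_cvgP gb; apply/sym_tensor_cvgP => i.
have oV := chart_open i; rewrite -/(chart_image i) in oV.
have sT (u v : one_form M n) : smooth_on (chart_image i)
    (fun y => (form_in_chart i u y)^T *m form_in_chart i v y).
  exact: (smooth_on_mulTmx oV (form_smooth u i) (form_smooth v i)).
have cT (u v : T -> one_form M n) (u0 v0 : one_form M n) :
    jet_cvg (chart_image i) (F := F) (fun t => form_in_chart i (u t)) (form_in_chart i u0) ->
    jet_cvg (chart_image i) (F := F) (fun t => form_in_chart i (v t)) (form_in_chart i v0) ->
    jet_cvg (chart_image i) (F := F)
      (fun t y => (form_in_chart i (u t) y)^T *m form_in_chart i (v t) y)
      (fun y => (form_in_chart i u0 y)^T *m form_in_chart i v0 y).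
  have su t := form_smooth (u t) i; have sv t := form_smooth (v t) i.
  have su0 := form_smooth u0 i; have sv0 := form_smooth v0 i.
  move=> uu vv; exact: (jet_cvg_mulmx oV (fun t => smooth_on_trmx oV (su t))
    (smooth_on_trmx oV su0) sv sv0 (jet_cvg_trmx oV su su0 uu) vv).
rewrite sym_product_in_chart.
have -> : (fun t => tensor_in_chart i (sym_product (f t) (g t))) = fun t =>
    2^-1 \*: ((fun y => (form_in_chart i (f t) y)^T *m form_in_chart i (g t) y) \+
            (fun y => (form_in_chart i (g t) y)^T *m form_in_chart i (f t) y)).
  by apply/funext => t; exact: sym_product_in_chart.
apply: (jet_cvgZ oV); first by move=> t; apply: (smooth_onD oV).
- exact: (smooth_onD oV).
- exact: cvg_cst.
apply: (jet_cvgD oV); [by move=> t; exact: sT|exact: sT|by move=> t; exact: sT|exact: sT| |].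
  exact: (cT _ _ _ _ (fa i) (gb i)).
exact: (cT _ _ _ _ (gb i) (fa i)).
Qed.

Lemma sym_tensor_cvgD {T : Type} {F : set_system T} {FF : Filter F}
    (f g : T -> sym_tensor M) h k :
  f @ F --> h -> g @ F --> k -> (fun t => f t + g t) @ F --> h + k.
Proof.
move=> /sym_tensor_cvgP fa /sym_tensor_cvgP gb; apply/sym_tensor_cvgP => i.
have oV := chart_open i; rewrite -/(chart_image i) in oV.
rewrite tensor_in_chartD; under eq_fun do rewrite tensor_in_chartD.
apply: (jet_cvgD oV) => //; by [move=> t; exact: tensor_smooth|exact: tensor_smooth].
Qed.

Lemma sym_tensor_cvgZ {T : Type} {F : set_system T} {FF : Filter F}
    (c : T -> R) (d : R) (f : T -> sym_tensor M) h :
  c @ F --> d -> f @ F --> h -> (fun t => c t *: f t) @ F --> d *: h.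
Proof.
move=> cd /sym_tensor_cvgP fa; apply/sym_tensor_cvgP => i.
have oV := chart_open i; rewrite -/(chart_image i) in oV.
rewrite tensor_in_chartZ; under eq_fun do rewrite tensor_in_chartZ.
apply: (jet_cvgZ oV) => //; by [move=> t; exact: tensor_smooth|exact: tensor_smooth].
Qed.

(** The matrix in a chart at a point depends continuously on the tensor field, and
    it determines the tensor at that point as the frame is invertible. *)
Lemma sym_tensor_hausdorff {F : set_system R} {PF : ProperFilter F}
    (f : R -> sym_tensor M) (h k : sym_tensor M) : f @ F --> h -> f @ F --> k -> h = k.
Proof.
move=> /sym_tensor_cvgP fh /sym_tensor_cvgP fk; apply: sym_tensor_eq => x.
set i := chart_at x; have ix : dom i x by exact: dom_chart_at.
suff E : tensor_in_chart i h (chart i x) = tensor_in_chart i k (chart i x).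
  have Cu := chart_frame_unit ix.
  move: E; rewrite /tensor_in_chart chartK// => /(congr1 (mulmx^~ (invmx (chart_frame i x)))).
  rewrite !mulmxK// => /(congr1 (mulmx (invmx (chart_frame i x)^T))).
  by rewrite !mulKmx ?unitmx_tr.
have c (l : sym_tensor M) :
    (forall i : atlas M, jet_cvg (chart_image i) (F := F)
       (fun t => tensor_in_chart i (f t)) (tensor_in_chart i l)) ->
    (fun t => tensor_in_chart i (f t) (chart i x)) @ F --> tensor_in_chart i l (chart i x).
  move=> fl; apply/cvgrPdist_le => e e0.
  have KV : [set chart i x] `<=` chart_image i by move=> _ ->; exact: chart_image_chart.
  apply: filterS (fl i [::] [set chart i x] (@compact_set1 _ _) KV e e0) => t ht.
  by rewrite distrC; exact: ht.
exact: (cvg_unique (@norm_hausdorff _ _) (c _ fh) (c _ fk)).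
Qed.

End SymmetricProduct.

Section Quadratic.
Context {R : realType} {m n : nat} (M : manifold R m).

Definition continuous_linear {E : preTopologicalLmodType R} (L : E -> one_form M n) :=
  [/\ continuous L, forall x y, L (x + y) = L x + L y & forall c x, L (c *: x) = c *: L x].

(** The space E varies: the differential of a quadratic map on E
    is a quadratic map on E * E, which makes the iterated differentials
    accessible to induction. *)
Inductive quadratic {E : preTopologicalLmodType R} : (E -> sym_tensor M) -> Prop :=
| quadratic_product L1 L2 : continuous_linear L1 -> continuous_linear L2 ->
    quadratic (fun x => sym_product (L1 x) (L2 x))
| quadraticD f g : quadratic f -> quadratic g -> quadratic (fun x => f x + g x).

Lemma quadratic_continuous {E : preTopologicalLmodType R} (f : E -> sym_tensor M) :
  quadratic f -> continuous f.
Proof.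
elim=> {f}[L1 L2 [c1 _ _] [c2 _ _] x|f g _ cf _ cg x].
  by apply: sym_product_cvg; [exact: c1|exact: c2].
by apply: sym_tensor_cvgD; [exact: cf|exact: cg].
Qed.

(** For t != 0 the difference quotient exceeds the derivative by the term
    t *: B(L1 v, L2 v). *)
Lemma sym_product_dderiv {E : preTopologicalLmodType R} (L1 L2 : E -> one_form M n) x v :
  continuous_linear L1 -> continuous_linear L2 ->
  is_dderiv (fun x => sym_product (L1 x) (L2 x)) x v
    (sym_product (L1 x) (L2 v) + sym_product (L1 v) (L2 x)).
Proof.
move=> [_ D1 Z1] [_ D2 Z2]; rewrite /is_dderiv.
set k := _ + _; set l := sym_product (L1 v) (L2 v).
have h : (fun t : R => k + t *: l) @ (0 : R)^' --> k + 0 *: l.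
  apply: sym_tensor_cvgD; first exact: cvg_cst.
  apply: sym_tensor_cvgZ; last exact: cvg_cst.
  exact: (@nbhs_dnbhs R 0).
rewrite scale0r addr0 in h; apply: cvg_trans h; apply: near_eq_cvg.
have n0 : \forall t \near (0 : R)^', t != 0 by apply: (@filterE _ (nbhs (0 : R))).
apply: filterS n0 => t t0 /=.
rewrite D1 D2 Z1 Z2 !sym_productDl !sym_productDr !sym_productZl !sym_productZr.
rewrite [in RHS]addrC !addrA addNr add0r !scalerDr !scalerA.
by rewrite mulKf// mulVf// !scale1r.
Qed.

Lemma is_dderivD {E : preTopologicalLmodType R} (f g : E -> sym_tensor M) x v k l :
  is_dderiv f x v k -> is_dderiv g x v l ->
  is_dderiv (fun x => f x + g x) x v (k + l).
Proof.
move=> fk gl; rewrite /is_dderiv.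
rewrite (_ : (fun t => _) = fun t =>
  t^-1 *: (f (x + t *: v) - f x) + t^-1 *: (g (x + t *: v) - g x)).
  exact: sym_tensor_cvgD.
by apply/funext => t; rewrite -scalerDr opprD addrACA.
Qed.

Lemma quadratic_dderiv {E : preTopologicalLmodType R} (f : E -> sym_tensor M) :
  quadratic f -> exists2 df : (E * E)%type -> sym_tensor M, quadratic df &
    forall x v, is_dderiv f x v (df (x, v)).
Proof.
elim=> {f}[L1 L2 l1 l2|f g _ [df qf dfP] _ [dg qg dgP]]; last first.
  exists (fun xv => df xv + dg xv); first exact: quadraticD.
  by move=> x v; exact: is_dderivD.
exists (fun xv => sym_product (L1 xv.1) (L2 xv.2) + sym_product (L1 xv.2) (L2 xv.1)).
  have fstl L : continuous_linear L -> continuous_linear (fun xv : (E * E)%type => L xv.1).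
    move=> [c D Z]; split=> [xv|xv yw|a xv]; [|exact: D|exact: Z].
    apply: (@continuous_comp _ _ _ fst L); last exact: c.
    exact: cvg_fst.
  have sndl L : continuous_linear L -> continuous_linear (fun xv : (E * E)%type => L xv.2).
    move=> [c D Z]; split=> [xv|xv yw|a xv]; [|exact: D|exact: Z].
    apply: (@continuous_comp _ _ _ snd L); last exact: c.
    exact: cvg_snd.
  by apply: quadraticD; apply: quadratic_product; do [exact: fstl|exact: sndl].
by move=> x v; exact: sym_product_dderiv.
Qed.

Lemma quadratic_Ck k {E : preTopologicalLmodType R} (U : set E) (f : E -> sym_tensor M) :
  quadratic f -> Ck k U f.
Proof.
elim: k E U f => [|k IH] E U f qf.
  by split=> //; apply: continuous_subspaceT; exact: quadratic_continuous.
split; first by apply: continuous_subspaceT; exact: quadratic_continuous.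
have [df qdf dfP] := quadratic_dderiv qf.
by exists df => //; exact: IH.
Qed.

Lemma id_continuous_linear : continuous_linear (@id (one_form M n)).
Proof. by split=> // x; exact: cvg_id. Qed.

Lemma pullback_metric_Ck k (U : set (one_form M n)) : Ck k U (@pullback_metric R m n M).
Proof.
have -> : @pullback_metric R m n M = fun a => sym_product a a.
  by apply/funext => a; exact: pullback_metricE.
apply: quadratic_Ck; exact: (quadratic_product id_continuous_linear id_continuous_linear).
Qed.

Lemma pullback_metric_differential (a : one_form M n) :
  is_differential pullback_metric a (fun v => 2 *: sym_product a v).
Proof.
move=> v; have -> : @pullback_metric R m n M = fun a => sym_product a a.
  by apply/funext => b; exact: pullback_metricE.
have := sym_product_dderiv (x := a) (v := v) id_continuous_linear id_continuous_linear.
by rewrite [sym_product v a]sym_productC -mulr2n scaler_nat.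
Qed.

Lemma pullback_metric_differential_unique (a : one_form M n) D :
  is_differential pullback_metric a D -> D = fun v => 2 *: sym_product a v.
Proof.
move=> aD; apply/funext => v.
exact: (sym_tensor_hausdorff (aD v) (@pullback_metric_differential a v)).
Qed.

End Quadratic.

(** * Horizontal lifts and surjectivity *)

Section PointwiseAlgebra.
Context {R : realType} {p q : nat}.
Implicit Types (a u v : 'M[R]_(q, p)) (h k g C : 'M[R]_p).

(** The inverse of the Gram matrix transforms as a contravariant tensor; this is
    what makes the formulas in charts agree with the pointwise ones. *)
Lemma mulmx_inv_congr g C : g \in unitmx -> C \in unitmx ->
  C *m invmx (C^T *m g *m C) *m C^T = invmx g.
Proof.
move=> gu Cu; have Gu : C^T *m g *m C \in unitmx by rewrite !unitmx_mul unitmx_tr Cu gu.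
rewrite -[LHS](mulmxK gu) -[RHS]mul1mx; congr (_ *m _).
rewrite -!mulmxA -[X in _ *m (_ *m X)](mulmxK Cu) !mulmxA.
rewrite -[C *m _ *m C^T]mulmxA -[C *m _ *m g]mulmxA -[C *m _ *m C]mulmxA.
have -> : invmx (C^T *m g *m C) *m C^T *m g *m C = 1%:M.
  by rewrite -!mulmxA [C^T *m _]mulmxA mulVmx.
by rewrite mulmx1 mulmxV.
Qed.

(** The horizontal lift at a point of the tangent vector h to the space of
    metrics. *)
Definition lift_mx a h : 'M[R]_(q, p) := 2^-1 *: (a *m invmx (a^T *m a) *m h).

Lemma lift_mxK a h : spd (a^T *m a) -> h^T = h ->
  a^T *m lift_mx a h + (lift_mx a h)^T *m a = h.
Proof.
move=> sg hT; have gu := spd_unit sg; rewrite /lift_mx.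
rewrite [(2^-1 *: _)^T]linearZ /= -scalemxAr -scalemxAl -scalerDr.
rewrite !trmx_mul hT trmx_inv sg.1 !mulmxA mulmxV// mul1mx -[h *m _ *m _ *m a]mulmxA mulmxKV//.
have -> : h + h = 2 *: h by rewrite scaler_nat mulr2n.
by rewrite scalerA mulVf ?scale1r// pnatr_eq0.
Qed.

(** Up to a factor this is the trace of the product of the antisymmetric matrix
    a^T u and the symmetric matrix g^-1 k g^-1. *)
Lemma trace_lift_mx_vertical a u k : spd (a^T *m a) -> k^T = k ->
  a^T *m u + u^T *m a = 0 ->
  \tr (u *m invmx (a^T *m a) *m (lift_mx a k)^T) = 0.
Proof.
move=> sg kT ua; rewrite /lift_mx; set g := a^T *m a.
have gT : (invmx g)^T = invmx g by rewrite trmx_inv sg.1.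
rewrite [(2^-1 *: _)^T]linearZ /= -scalemxAr linearZ /= !trmx_mul kT gT.
rewrite !mulmxA mxtrace_mulC !mulmxA.
set W := a^T *m u.
have WT : W^T = - W.
  by rewrite trmx_mul trmxK; apply/eqP; rewrite -addr_eq0 addrC ua.
move: W WT => W WT; set t := \tr _.
have tN : t = - t.
  rewrite -[LHS]mxtrace_tr !trmx_mul gT kT WT mulmxN mulmxN mulmxN linearN /= /t.
  by congr (- _); rewrite !mulmxA [LHS]mxtrace_mulC !mulmxA.
by have -> : t = 0; [lra|rewrite mulr0].
Qed.

Lemma trace_lift_mx a h k : spd (a^T *m a) -> h^T = h -> k^T = k ->
  \tr (lift_mx a h *m invmx (a^T *m a) *m (lift_mx a k)^T) =
  4^-1 * \tr (h *m invmx (a^T *m a) *m k *m invmx (a^T *m a)).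
Proof.
move=> sg hT kT; rewrite /lift_mx; set g := a^T *m a.
have gT : (invmx g)^T = invmx g by rewrite trmx_inv sg.1.
have gu := spd_unit sg.
rewrite [(2^-1 *: (_ *m k))^T]linearZ /= -!scalemxAl -scalemxAr scalerA linearZ /=.
rewrite !trmx_mul kT gT !mulmxA mxtrace_mulC !mulmxA mulmxV// mul1mx.
by congr (_ * _); rewrite -invfM -natrM.
Qed.

(** Applied to the geometric mean h of a^T a and g, the right-hand side is g. *)
Lemma gram_mulmx_inv a h : spd (a^T *m a) -> h^T = h ->
  (a *m invmx (a^T *m a) *m h)^T *m (a *m invmx (a^T *m a) *m h) =
  h *m invmx (a^T *m a) *m h.
Proof.
move=> sg hT; rewrite !trmx_mul hT trmx_inv sg.1; have gu := spd_unit sg.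
rewrite -!mulmxA [a^T *m (a *m _)]mulmxA; move: (a^T *m a) gu => g gu.
by rewrite !mulmxA mulmxKV.
Qed.

Lemma trace_spd_quad_ge0 g u : spd g -> 0 <= \tr (u *m invmx g *m u^T).
Proof. by move=> sg; have := trace_spd_ge0 u^T (spd_inv sg); rewrite trmxK. Qed.

Lemma trace_spd_quad_eq0 g u : spd g -> \tr (u *m invmx g *m u^T) = 0 -> u = 0.
Proof.
move=> sg; have := trace_spd_eq0 (X := u^T) (spd_inv sg); rewrite trmxK => h /h /(congr1 trmx).
by rewrite trmxK trmx0.
Qed.

End PointwiseAlgebra.

Section HorizontalSection.
Context {R : realType} {m n : nat} (M : manifold R m).
Implicit Types (i : atlas M) (x : M).

Lemma full_rankedP (a : one_form M n) x : full_ranked n M a -> spd ((a x)^T *m a x).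
Proof.
move=> fa; apply: spd_gram => v; apply: contra => /eqP av; apply/eqP.
by apply: (fa x); rewrite /= av mulmx0.
Qed.

Lemma gram_in_chart (a : one_form M n) i y :
  (form_in_chart i a y)^T *m form_in_chart i a y =
  (chart_frame i (param i y))^T *m ((a (param i y))^T *m a (param i y)) *m
  chart_frame i (param i y).
Proof. by rewrite /form_in_chart trmx_mul !mulmxA. Qed.

Lemma frame_unit i y : chart_image i y -> chart_frame i (param i y) \in unitmx.
Proof. by move=> iy; apply: chart_frame_unit; exact: chart_image_dom. Qed.

Lemma spd_in_chart i y (g : 'M[R]_m) : chart_image i y -> spd g ->
  spd ((chart_frame i (param i y))^T *m g *m chart_frame i (param i y)).
Proof. by move=> iy sg; apply: spd_congr => // v; exact/unitmx_injective/frame_unit. Qed.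

Lemma gram_chart_spd (a : one_form M n) i y : full_ranked n M a -> chart_image i y ->
  spd ((form_in_chart i a y)^T *m form_in_chart i a y).
Proof.
move=> fa iy; rewrite gram_in_chart; apply: spd_in_chart => //.
exact: full_rankedP.
Qed.

(** The formula for the horizontal lift holds verbatim in the coordinates of
    every chart. *)
Lemma lift_mx_in_chart (a : one_form M n) (h : M -> 'M[R]_m) i y :
  full_ranked n M a -> chart_image i y ->
  form_in_chart i (fun x => lift_mx (a x) (h x)) y =
  lift_mx (form_in_chart i a y) (tensor_in_chart i h y).
Proof.
move=> fa iy; have Cu := frame_unit iy; have gu := spd_unit (full_rankedP (param i y) fa).
rewrite /lift_mx gram_in_chart {1}/form_in_chart -(mulmx_inv_congr gu Cu).
by rewrite /form_in_chart /tensor_in_chart -scalemxAl !mulmxA.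
Qed.

Lemma smooth_on_lift_coefficient (a : one_form M n) i : full_ranked n M a ->
  smooth_on (chart_image i) (fun y => 2^-1 *: (form_in_chart i a y *m
    invmx ((form_in_chart i a y)^T *m form_in_chart i a y))).
Proof.
move=> fa; have oV := chart_open i; have sA := form_smooth a i.
apply: (smooth_onZ oV); apply: (smooth_on_mulmx oV sA).
apply: (smooth_on_invmx oV); last exact: (smooth_on_mulTmx oV sA sA).
by move=> y iy; apply: spd_unit; exact: gram_chart_spd.
Qed.

Lemma horizontal_lift_smooth (a : one_form M n) (h : sym_tensor M) : full_ranked n M a ->
  (fun x => lift_mx (a x) (h x)) \in smooth_form M.
Proof.
move=> fa; apply/asboolP => i; have oV := chart_open i.
apply: (smooth_on_eq oV) (smooth_on_mulmx oV (smooth_on_lift_coefficient i fa) (tensor_smooth h i)).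
by move=> y iy; rewrite lift_mx_in_chart// /lift_mx -scalemxAl.
Qed.

Definition horizontal_lift (a : one_form M n) (fa : full_ranked n M a)
    (h : sym_tensor M) : one_form M n :=
  OneForm (horizontal_lift_smooth h fa).

Lemma horizontal_liftE a fa h x : @horizontal_lift a fa h x = lift_mx (a x) (h x).
Proof. by []. Qed.

Lemma horizontal_lift_linear a fa : linear (@horizontal_lift a fa).
Proof.
move=> c h k; apply: one_form_eq => x.
rewrite one_form_linE !horizontal_liftE /lift_mx sym_tensorD sym_tensorZ.
by rewrite mulmxDr -scalemxAr scalerDr !scalerA mulrC.
Qed.

HB.instance Definition _ a fa := GRing.isLinear.Build R (sym_tensor M) (one_form M n)
  *:%R (@horizontal_lift a fa) (@horizontal_lift_linear a fa).

(** In charts the lift is the product by a fixed smooth matrix-valued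
    function. *)
Lemma horizontal_lift_continuous a fa : continuous (@horizontal_lift a fa).
Proof.
move=> h; have FF : Filter (nbhs h) := nbhs_filter h.
apply/(@one_form_cvgP _ _ M n _ _ FF) => i.
have oV := chart_open i; rewrite -/(chart_image i) in oV.
have ch : jet_cvg (chart_image i) (F := nbhs h)
    (fun t : sym_tensor M => tensor_in_chart i t) (tensor_in_chart i h).
  by apply: (@sym_tensor_cvgP _ _ M _ _ FF id h).1; exact: cvg_id.
have sB := smooth_on_lift_coefficient i fa.
move=> w; apply: (jet_cvg_at_eq oV _ _ (jet_cvg_mulmx oV (fun=> sB) sB
  (fun t => tensor_smooth t i) (tensor_smooth h i) (jet_cvg_cst _) ch w)).
- by move=> t y iy; rewrite lift_mx_in_chart// /lift_mx -scalemxAl.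
- by move=> y iy; rewrite lift_mx_in_chart// /lift_mx -scalemxAl.
Qed.

Lemma horizontal_liftK a fa h : 2 *: sym_product a (@horizontal_lift a fa h) = h.
Proof.
apply: sym_tensor_eq => x; rewrite sym_tensorZ sym_productE scalerA mulfV ?scale1r ?pnatr_eq0//.
by apply: lift_mxK; [exact: full_rankedP|exact: tensor_sym].
Qed.

Lemma pullback_metric_submersion : submersion (full_ranked n M) (@pullback_metric R m n M).
Proof.
split=> [k|a fa]; first exact: pullback_metric_Ck.
exists (fun v => 2 *: sym_product a v); first exact: pullback_metric_differential.
exists (@horizontal_lift a fa); split; first exact: horizontal_lift_continuous.
by move=> h; exact: horizontal_liftK.
Qed.

Lemma metric_spd (g : sym_tensor M) x : metrics M g -> spd (g x).
Proof. by move=> mg; split; [exact: tensor_sym|exact: mg]. Qed.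

Lemma pullback_metric_metrics a : full_ranked n M a -> metrics M (pullback_metric a).
Proof. by move=> fa x; exact: (full_rankedP x fa).2. Qed.

(** If s is the geometric mean of g0 = a0^T a0 and g, then a0 g0^-1 s pulls back
    the Euclidean scalar product to s g0^-1 s = g. In a chart with frame C, the
    matrix C^T s C solves the Riccati equation of C^T g0 C and C^T g C, hence it
    is smooth. *)
Lemma pullback_metric_surjective (a0 : one_form M n) (g : sym_tensor M) :
  full_ranked n M a0 -> metrics M g ->
  exists2 a, full_ranked n M a & pullback_metric a = g.
Proof.
move=> fa0 mg; pose g0 x := (a0 x)^T *m a0 x.
have sg0 x : spd (g0 x) by exact: full_rankedP.
have sg x : spd (g x) by exact: metric_spd.
pose s x := geometric_mean (g0 x) (g x).
have sP x : spd (s x) /\ s x *m invmx (g0 x) *m s x = g x by exact: geometric_meanP.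
pose al x := a0 x *m invmx (g0 x) *m s x.
have sal : al \in smooth_form M.
  apply/asboolP => i; have oV := chart_open i.
  pose A := form_in_chart i a0; have sA : smooth_on (chart_image i) A := form_smooth a0 i.
  have sG : smooth_on (chart_image i) (fun y => (A y)^T *m A y) := smooth_on_mulTmx oV sA sA.
  have pG y : chart_image i y -> spd ((A y)^T *m A y) by exact: gram_chart_spd.
  have sGi : smooth_on (chart_image i) (fun y => invmx ((A y)^T *m A y)).
    by apply: (smooth_on_invmx oV _ sG) => y iy; apply: spd_unit; exact: pG.
  have sS : smooth_on (chart_image i) (tensor_in_chart i s).
    apply: (smooth_on_geometric_mean oV pG _ _ _ sG (tensor_smooth g i)).
    - by move=> y iy; exact: spd_in_chart.
    - by move=> y iy; apply: spd_in_chart => //; exact: (sP _).1.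
    move=> y iy; rewrite /A gram_in_chart /tensor_in_chart -(sP _).2.
    rewrite -(mulmx_inv_congr (spd_unit (sg0 (param i y))) (frame_unit iy)) /g0.
    by rewrite !mulmxA.
  apply: (smooth_on_eq oV) (smooth_on_mulmx oV (smooth_on_mulmx oV sA sGi) sS) => y iy.
  rewrite /A gram_in_chart /tensor_in_chart /form_in_chart /al.
  rewrite -(mulmx_inv_congr (spd_unit (sg0 (param i y))) (frame_unit iy)) /g0.
  by rewrite !mulmxA.
have pal x : (al x)^T *m al x = g x.
  by rewrite -(sP x).2; exact: (gram_mulmx_inv (sg0 x) (sP x).1.1).
exists (OneForm sal); last by apply: sym_tensor_eq => x; exact: pal.
move=> x v w /= vw; apply/eqP; rewrite -subr_eq0; apply/negP => /negP /(sg x).2.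
have z : al x *m (v - w) = 0 by rewrite mulmxBr vw subrr.
by rewrite -pal mulmxA -[_ *m al x *m _]mulmxA z mulmx0 mxE ltxx.
Qed.

End HorizontalSection.

(** * Partitions of unity *)

Lemma compact_finite_subcover (T : topologicalType) (U : T -> set T) :
  compact [set: T] -> (forall x, nbhs x (U x)) ->
  exists D : seq T, forall y, exists2 x, x \in D & U x y.
Proof.
move=> /compact_near_coveringP cT nU.
(* The sets of finite families that contain all families larger than some D0. *)
pose F : set_system (seq T) :=
  [set A | exists D0 : seq T, forall D : seq T, {subset D0 <= D} -> A D].
have FF : Filter F.
  split; first by exists [::].
    move=> A B [D0 h0] [D1 h1]; exists (D0 ++ D1) => D sD; split.
      by apply: h0 => x xD; apply: sD; rewrite mem_cat xD.
    by apply: h1 => x xD; apply: sD; rewrite mem_cat xD orbT.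
  by move=> A B AB [D0 h]; exists D0 => D /h /AB.
have := cT _ F (fun (D : seq T) y => exists2 x, x \in D & U x y) FF.
case=> [|D0 /(_ D0 (fun _ => id)) h]; last by exists D0 => y; exact: h.
move=> x _; have FD : F [set D : seq T | x \in D] by exists [:: x] => D; apply; rewrite inE.
suff : filter_prod (nbhs x) F [set p : T * seq T | exists2 x, x \in p.2 & U x p.1] by [].
exists (U x, [set D : seq T | x \in D]); first by split; [exact: nU|].
by move=> [y D] /= [Uxy xD]; exists x.
Qed.

Section PartitionOfUnity.
Context {R : realType} {m : nat} (M : manifold R m) (cM : compact [set: M]).

(** Urysohn's lemma in a compact Hausdorff space, with a neighborhood of x whose
    closure is still in the domain of the chart. *)
Lemma bump_function (x : M) : exists f : M -> R, [/\ continuous f, forall y, 0 <= f y,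
  f x = 1 & closure [set y | f y != 0] `<=` dom (chart_at x)].
Proof.
have hM := @points_hausdorff _ _ M.
have xd : nbhs x (dom (chart_at x)).
  by apply: open_nbhs_nbhs; split; [exact: dom_open|exact: dom_chart_at].
have [W Wx Wd] := compact_regular hM cM (filterT : nbhs x setT) xd.
have xc : closed [set x] by exact: (accessible_closed_set1 (hausdorff_accessible hM)).
have [|f [cf f01 f0 f1]] := (uniform_separatorP (R := R) (~` W^°) [set x]).1.
  have H := (@normal_separatorP R M).1 (compact_normal hM cM) (~` W^°) [set x].
  apply: H => //.
    by apply: open_closedC; exact: open_interior.
  by apply/seteqP; split=> // y [nW yx]; apply: nW; rewrite yx.
exists f; split=> //.
- by move=> y; have := f01 (f y) (ex_intro2 _ _ y I erefl); rewrite /= in_itv /= => /andP[].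
- by apply: f1; exists x.
- apply: subset_trans Wd; apply: closureS => y /= fy.
  apply: interior_subset; apply: contrapT => nW; move/eqP: fy; apply.
  by apply: f0; exists y.
Qed.

Lemma partition_of_unity_exists : exists P : seq (atlas M * (M -> R)), partition_of_unity P.
Proof.
have [f fP] := choice bump_function.
have [|D cD] := @compact_finite_subcover M (fun x => [set y | f x y != 0]) cM.
  move=> x; have [cfx _ fx1 _] := fP x.
  by apply: (cvgr_neq0 _ (cfx x)); rewrite fx1 oner_neq0.
pose F y := \sum_(x <- D) f x y.
have F0 y : 0 < F y.
  have [x Dx fxy] := cD y.
  rewrite /F (big_rem x)//= ltr_wpDr//.
    by apply: sumr_ge0 => z _; have [_ + _ _] := fP z; exact.
  by have [_ + _ _] := fP x => /(_ y); rewrite le_eqVlt eq_sym (negbTE fxy).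
have cF : continuous F.
  move=> y; apply: (cvg_big add_continuous) => x _.
  by have [+ _ _ _] := fP x; exact.
exists [seq (chart_at x, fun y => f x y / F y) | x <- D]; split.
  move=> _ /mapP[x Dx ->] /=; have [cfx fx0 _ fxd] := fP x; split.
  - move=> y; apply: cvgM; first exact: cfx.
    by apply: cvgV; [rewrite gt_eqF|exact: cF].
  - by move=> y; rewrite divr_ge0// ltW.
  - apply: subset_trans fxd; apply: closureS => y /=.
    by apply: contra => /eqP ->; rewrite mul0r.
by move=> y; rewrite big_map /= -mulr_suml mulfV// gt_eqF// -/(F y).
Qed.

End PartitionOfUnity.

(** * Lebesgue integration in charts *)

Section TupleMeasure.
Context {R : realType}.
Local Notation rT := (measurableTypeR R).

Definition open_box n (a b : nat -> R) : set (n.-tuple rT) :=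
  [set t | forall k : 'I_n, a k < tnth t k < b k].

Lemma open_box_measurable n a b : measurable (@open_box n a b).
Proof.
rewrite (_ : open_box _ _ = \bigcap_(k in [set: 'I_n])
    [set t : n.-tuple rT | `]a k, b k[%classic (tnth t k)]).
  apply: fin_bigcap_measurable => // k _; rewrite -[X in measurable X]setTI.
  exact: (measurable_tnth k).
apply/seteqP; split=> t /= h k; first by move=> _; rewrite /= in_itv /=; exact: h.
by have := h k I; rewrite /= in_itv.
Qed.

Lemma open_box_measure n (a b : nat -> R) : (forall k, a k < b k) ->
  (0 < lebesgue_tuple n (@open_box n a b) < +oo)%E.
Proof.
elim: n a b => [|n IH] a b ab.
  rewrite (_ : open_box _ _ = setT) /= ?diracT ?lte01 ?ltry//.
  by apply/seteqP; split=> // t _ [].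
have E : @cons_pair R n @^-1` (open_box a b) =
    `]a 0%N, b 0%N[%classic `*` @open_box n (fun k => a k.+1) (fun k => b k.+1).
  apply/seteqP; split=> -[x t] /=.
    move=> h; split; first by have := h ord0; rewrite /= in_itv /= tnth0.
    by move=> k; have := h (lift ord0 k); rewrite /= tnthS.
  rewrite in_itv /= => -[h0 h] k; case: (unliftP ord0 k) => [j ->|->].
    by rewrite /= tnthS; exact: h.
  by rewrite /= tnth0.
rewrite /= /product_cons /pushforward E product_measure1E//; last exact: open_box_measurable.
have L : (lebesgue_measure (`]a 0%N, b 0%N[%classic : set R) = (b 0%N - a 0%N)%:E)%E.
  by rewrite lebesgue_measure_itv /= lte_fin ab -EFinD.
set X := (X in (X * _)%E); have -> : X = (b 0%N - a 0%N)%:E by exact: L.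
have /andP[p1 p2] := IH (fun k => a k.+1) (fun k => b k.+1) (fun k => ab k.+1).
rewrite mule_gt0 ?lte_fin ?subr_gt0//= lte_mul_pinfty// ?lee_fin ?subr_ge0 ?ltW//.
Qed.

(** An open set is the union of the countably many boxes with rational endpoints
    that it contains. *)
Lemma open_col_measurable n (U : set 'cV[R]_n) : open U ->
  measurable [set t : n.-tuple rT | U (col_of_tuple t)].
Proof.
move=> oU.
pose B (qr : n.-tuple (rat * rat)) : set (n.-tuple rT) :=
  @open_box n (fun k => ratr (nth (0, 0) qr k).1) (fun k => ratr (nth (0, 0) qr k).2).
pose D := [set qr | B qr `<=` [set t | U (col_of_tuple t)]].
rewrite (_ : [set t | _] = \bigcup_qr (if `[< D qr >] then B qr else set0)).
  apply: countable_bigcupT_measurable; first exact: countableP.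
  by move=> qr; case: ifPn => _; [exact: open_box_measurable|exact: measurable0].
apply/seteqP; split=> [t Ut|t [qr _]]; last by case: asboolP => // Dqr /Dqr.
have [e e0 he] : exists2 e : R, 0 < e & forall h : 'cV[R]_n,
    (forall k, `|h k 0| < e) -> U (col_of_tuple t + h).
  by apply/nbhs_colP; apply: open_nbhs_nbhs.
have ex k : exists qr : rat * rat, [&& tnth t k - e < ratr qr.1,
    ratr qr.1 < tnth t k, tnth t k < ratr qr.2 & ratr qr.2 < tnth t k + e].
  have tl : tnth t k - e < tnth t k by rewrite ltrBlDr ltrDl.
  have tr : tnth t k < tnth t k + e by rewrite ltrDl.
  have [q1] := @rat_in_itvoo R _ _ tl; have [q2] := @rat_in_itvoo R _ _ tr.
  rewrite !in_itv /= => /andP[? ?] /andP[? ?].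
  by exists (q1, q2); apply/and4P.
have [qr qrP] := choice ex.
have nqr (k : 'I_n) : nth (0, 0) (mktuple qr) k = qr k.
  by rewrite (nth_map k) ?size_enum_ord// nth_ord_enum.
exists (mktuple qr) => //; case: asboolP => [_ k|nD].
  by rewrite nqr; have /and4P[_ -> -> _] := qrP k.
case: nD => s Bs /=; rewrite -[col_of_tuple s](subrK (col_of_tuple t)) addrC; apply: he => k.
rewrite !mxE; have := Bs k; rewrite nqr => /andP[s1 s2].
have /and4P[h1 h2 h3 h4] := qrP k.
by rewrite ltr_norml; apply/andP; split; lra.
Qed.

Lemma halfspace_closed n : closed (@halfspace R n).
Proof.
rewrite (_ : halfspace = \bigcap_(k in [set k : 'I_n | k = 0%N :> nat])
   (fun y : 'cV[R]_n => y k 0) @^-1` [set x | 0 <= x]).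
  apply: closed_bigI => k _; apply: closed_comp; last exact: closed_ge.
  by move=> y _; exact: coord_continuous.
by apply/seteqP; split=> y h k; exact: h.
Qed.

Lemma relatively_open_measurable n (V : set 'cV[R]_n) : relatively_open V ->
  measurable [set t : n.-tuple rT | V (col_of_tuple t)].
Proof.
move=> [U oU ->]; apply: measurableI; first exact: open_col_measurable.
rewrite -[X in measurable X]setCK; apply: measurableC.
by have := open_col_measurable (closed_openC (@halfspace_closed n)).
Qed.

Lemma continuous_col_measurable n (V : set 'cV[R]_n) (f : 'cV[R]_n -> R) :
  relatively_open V -> {within V, continuous f} ->
  measurable_fun [set t : n.-tuple rT | V (col_of_tuple t)] (f \o @col_of_tuple R n).
Proof.
move=> oV cf mD; apply: (measurability _ (RGenOInfty.measurableE R)) => //.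
move=> _ [_ [a ->] <-].
have oB : open (`]a, +oo[%classic : set R) by exact: interval_open.
by have := relatively_open_measurable (relatively_open_preimage oV cf oB).
Qed.

Section Integral.
Context (n : nat) (V : set 'cV[R]_n) (oV : relatively_open V) (F : 'cV[R]_n -> R)
  (cF : {within V, continuous F}).
Let D : set (n.-tuple rT) := [set t | V (col_of_tuple t)].
Let f : n.-tuple rT -> R := F \o @col_of_tuple R n.

Lemma compact_support_integrable (K : set 'cV[R]_n) : compact K -> K `<=` V ->
  (forall y, V y -> ~ K y -> F y = 0) ->
  (lebesgue_tuple n).-integrable D (EFin \o f).
Proof.
move=> cK KV F0; have mD : measurable D := relatively_open_measurable oV.
have [C C0 HC] := compact_bounded_on cF cK KV.
have [B B0 HB] : exists2 B : R, 0 < B & forall y, K y -> `|y| <= B.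
  exact: (@compact_bounded_on R n V _ (id : 'cV[R]_n -> 'cV[R]_n) K
    (continuous_subspaceT (fun x => cvg_id)) cK KV).
(* The strict inequalities of an open box require the margin 1. *)
pose E := D `&` @open_box n (fun=> - (B + 1)) (fun=> B + 1).
have mE : measurable E by apply: measurableI => //; exact: open_box_measurable.
have mf : measurable_fun D f := continuous_col_measurable oV cF.
have EK t : D t -> ~ E t -> f t = 0.
  move=> Dt nE; apply: F0 => // Kt; apply: nE; split=> // k.
  have := HB _ Kt => /(mx_norm_leP _ (ltW B0))/(_ k 0); rewrite mxE.
  by rewrite ler_norml => /andP[? ?]; apply/andP; split; lra.
have fin : (lebesgue_tuple n E < +oo)%E.
  have BB : - (B + 1) < B + 1 by lra.
  have /andP[_] := @open_box_measure n (fun=> - (B + 1)) (fun=> B + 1) (fun=> BB).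
  apply: le_lt_trans; apply: le_measure; rewrite ?inE//; last exact: subIsetr.
  exact: open_box_measurable.
have iE : (lebesgue_tuple n).-integrable E (EFin \o f).
  apply: measurable_bounded_integrable => //.
    by apply: measurable_funS mf => //; exact: subIsetl.
  exists C; split; first exact: num_real.
  move=> M CM t [Dt _] /=; apply: (le_trans _ (ltW CM)).
  have [Kt|nKt] := pselect (K (col_of_tuple t)); first exact: HC.
  by rewrite /f /= F0// normr0 ltW.
move: iE; rewrite (integrable_mkcond _ mE) (integrable_mkcond _ mD).
rewrite (_ : (EFin \o f) \_ E = (EFin \o f) \_ D)//.
apply/funext => t; rewrite !patchE.
have [tD|tD] := boolP (t \in D); last first.
  by rewrite ifN//; apply: contra tD; rewrite !inE => -[].
case: ifPn => // tE; rewrite /= EK//; first by rewrite inE in tD.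
by move: tE; rewrite notin_setE.
Qed.

(** Where F is positive it is bounded below on a small box. The box is put on the
    side of the larger coordinates, so that it stays in the half-space. *)
Lemma integral_eq0_continuous : (forall y, V y -> 0 <= F y) ->
  (lebesgue_tuple n).-integrable D (EFin \o f) ->
  integral_Rn V F = 0 -> forall y, V y -> F y = 0.
Proof.
move=> F0 iF I0 y Vy; have mD : measurable D := relatively_open_measurable oV.
have mf : measurable_fun D f := continuous_col_measurable oV cF.
have I0' : (\int[lebesgue_tuple n]_(t in D) (f t)%:E = 0)%E.
  by rewrite -[LHS]fineK ?integrable_fin_num//; congr (_%:E).
apply/eqP; rewrite eq_le F0// andbT leNgt; apply/negP => Fy.
have [e e0 he] : exists2 e : R, 0 < e & forall h : 'cV[R]_n, (forall k, `|h k 0| < e) ->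
    V (y + h) -> F y / 2 < F (y + h).
  apply: (nbhs_colP y [set z | V z -> F y / 2 < F z]).1.
  have := (subspace_continuousP _ _).1 cF y Vy.
  have Fy2 : F y / 2 < F y by lra.
  by move=> /cvgr_gt/(_ _ Fy2).
have [U oU VE] := oV.
have [d d0 hd] : exists2 d : R, 0 < d &
    forall h : 'cV[R]_n, (forall k, `|h k 0| < d) -> U (y + h).
  by apply/nbhs_colP; move: Vy; rewrite VE => -[Uy _]; exact: open_nbhs_nbhs.
pose r := Num.min e d; have r0 : 0 < r by rewrite lt_min e0.
pose a k := if insub k is Some i then y i 0 else 0.
have aE (k : 'I_n) : a k = y k 0 by rewrite /a valK.
pose B : set (n.-tuple rT) := @open_box n a (fun k => a k + r).
have BD t : B t -> V (col_of_tuple t) /\ F y / 2 < f t.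
  move=> Bt.
  have h k : 0 < (col_of_tuple t - y) k 0 < r.
    by rewrite !mxE; have := Bt k; rewrite aE => /andP[? ?]; apply/andP; split; lra.
  have hr k : `|(col_of_tuple t - y) k 0| < r.
    by have /andP[h0 h1] := h k; rewrite gtr0_norm.
  have Vt : V (y + (col_of_tuple t - y)).
    rewrite VE; split.
      by apply: hd => k; apply: lt_le_trans (hr k) _; rewrite ge_min lexx orbT.
    move=> k k0; rewrite mxE; apply: addr_ge0.
      by have Hy := relatively_open_halfspace oV Vy; exact: Hy.
    by have /andP[/ltW] := h k.
  have re : r <= e by rewrite ge_min lexx.
  by have := he _ (fun k => lt_le_trans (hr k) re) Vt; rewrite subrKC in Vt *.
have mB : measurable B by exact: open_box_measurable.
have /andP[mB0 _] : (0 < lebesgue_tuple n B < +oo)%E.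
  by apply: open_box_measure => k; rewrite ltrDl.
have : ((F y / 2)%:E * lebesgue_tuple n B <= 0)%E.
  rewrite -I0' -integral_cst//.
  apply: (@le_trans _ _ (\int[lebesgue_tuple n]_(t in B) (f t)%:E)%E).
    apply: ge0_le_integral => //.
    - by move=> t _; rewrite lee_fin; lra.
    - apply/measurable_EFinP; apply: measurable_funS mf => // t /BD[]; exact.
    - by move=> t /BD[_ /ltW]; rewrite lee_fin.
  apply: ge0_subset_integral => //.
  - by apply/measurable_EFinP.
  - by move=> t Dt; rewrite lee_fin; exact: F0.
  - by move=> t /BD[].
by rewrite leNgt mule_gt0// lte_fin; lra.
Qed.

End Integral.
End TupleMeasure.

(** * Integration on the manifold and the Riemannian submersion *)

Section IntegralDensity.
Context {R : realType} {m : nat} (M : manifold R m) (cM : compact [set: M]).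
Implicit Types (i : atlas M) (d : atlas M -> 'cV[R]_m -> R).

Let P := xget [::] (@partition_of_unity R m M).

Let Pspec : partition_of_unity P.
Proof. by apply: xgetPex; exact: partition_of_unity_exists. Qed.

Lemma weighted_continuous d p : p \in P ->
  {within chart_image p.1, continuous (d p.1)} ->
  {within chart_image p.1, continuous (fun y => p.2 (param p.1 y) * d p.1 y)}.
Proof.
move=> pP cd y; have [cp _ _] := Pspec.1 p pP.
apply: cvgM; last exact: cd.
apply: (@continuous_comp (subspace (chart_image p.1)) M R); last exact: cp.
exact: param_continuous.
Qed.

(** The support of p.2 is compact, as a closed subset of M, and its image in the
    chart is compact and contained in the chart image. *)
Lemma weighted_integrable d p : p \in P ->
  {within chart_image p.1, continuous (d p.1)} ->
  (lebesgue_tuple m).-integrable [set t | chart_image p.1 (col_of_tuple t)]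
    (EFin \o ((fun y => p.2 (param p.1 y) * d p.1 y) \o @col_of_tuple R m)).
Proof.
move=> pP cd; have [cp p0 psupp] := Pspec.1 p pP.
pose S := closure [set x | p.2 x != 0].
apply: (@compact_support_integrable _ _ _ (chart_open p.1) _
  (weighted_continuous pP cd) (chart p.1 @` S)).
- apply: continuous_compact; last exact: (subclosed_compact (@closed_closure _ _) cM).
  exact: (continuous_subspaceW psupp (@chart_continuous _ _ M p.1)).
- by move=> _ [x Sx <-]; exact/chart_image_chart/psupp.
- move=> y iy nK; have [->|px] := eqVneq (p.2 (param p.1 y)) 0; first by rewrite mul0r.
  exfalso; apply: nK; exists (param p.1 y); last exact: paramK.
  exact: subset_closure.
Qed.

Lemma integral_density_eq d d' :
  (forall i y, chart_image i y -> d i y = d' i y) ->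
  integral_density d = integral_density d'.
Proof.
move=> dd; apply: eq_bigr => p _; apply: eq_Rintegral => t; rewrite inE => it.
by rewrite dd.
Qed.

Lemma integral_densityZ c d : (forall i, {within chart_image i, continuous (d i)}) ->
  integral_density (fun i y => c * d i y) = c * integral_density d.
Proof.
move=> cd; rewrite /integral_density mulr_sumr big_seq [RHS]big_seq; apply: eq_bigr => p pP.
rewrite /integral_Rn -RintegralZl; last exact: weighted_integrable.
  by apply: eq_Rintegral => t _; rewrite mulrCA.
exact: relatively_open_measurable (chart_open p.1).
Qed.

(** At every point x some weight of the partition of unity is nonzero, and the
    integral with this weight vanishes. *)
Lemma integral_density_eq0 d : (forall i, {within chart_image i, continuous (d i)}) ->
  (forall i y, chart_image i y -> 0 <= d i y) -> integral_density d = 0 ->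
  forall x, exists2 i, dom i x & d i (chart i x) = 0.
Proof.
move=> cd d0; rewrite /integral_density big_seq => I0 x.
have w0 p : p \in P -> forall y, chart_image p.1 y -> 0 <= p.2 (param p.1 y) * d p.1 y.
  by move=> pP y iy; have [_ p0 _] := Pspec.1 p pP; rewrite mulr_ge0// d0.
have I0p p : p \in P -> integral_Rn (chart_image p.1)
    (fun y => p.2 (param p.1 y) * d p.1 y) = 0.
  move=> pP; move: I0; rewrite -big_seq => /eqP.
  rewrite big_seq psumr_eq0 => [/allP/(_ p pP)/implyP/(_ pP)/eqP//|q qP].
  by apply: Rintegral_ge0 => t it; exact: w0.
have [p pP px] : exists2 p, p \in P & p.2 x != 0.
  apply/not_exists2P => H; have := Pspec.2 x.
  rewrite big_seq big1 => [/eqP|p pP]; first by rewrite eq_sym oner_eq0.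
  by have [//|px] := H p; apply: contrapT => /eqP.
have [_ _ psupp] := Pspec.1 p pP.
have ix : dom p.1 x by apply: psupp; exact: subset_closure.
exists p.1 => //; have := integral_eq0_continuous (chart_open p.1)
  (weighted_continuous pP (cd p.1)) (w0 p pP) (weighted_integrable pP (cd p.1))
  (I0p p pP) (chart_image_chart ix).
by rewrite chartK// => /eqP; rewrite mulf_eq0 (negbTE px) => /eqP.
Qed.

End IntegralDensity.

Section Metrics.
Context {R : realType} {m n : nat} (M : manifold R m) (cM : compact [set: M]).
Implicit Types (a u v : one_form M n).

Definition ebin_density a (F : M -> R) i y : R :=
  F (param i y) * Num.sqrt (\det ((form_in_chart i a y)^T *m form_in_chart i a y)).

(** The scalar product of two one-forms at a point, which does not depend on the
    basis of the tangent space: see ebin_pairing_in_chart. *)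
Definition ebin_pairing a u v (x : M) : R :=
  \tr (u x *m invmx ((a x)^T *m a x) *m (v x)^T).

Lemma ebin_pairing_in_chart a u v i y : full_ranked n M a -> chart_image i y ->
  \tr (form_in_chart i u y *m invmx ((form_in_chart i a y)^T *m form_in_chart i a y)
    *m (form_in_chart i v y)^T) = ebin_pairing a u v (param i y).
Proof.
move=> fa iy; rewrite /ebin_pairing gram_in_chart.
rewrite -(mulmx_inv_congr (spd_unit (full_rankedP (param i y) fa)) (frame_unit iy)).
by rewrite /form_in_chart trmx_mul !mulmxA.
Qed.

Lemma generalized_ebinE a u v : full_ranked n M a ->
  generalized_ebin a u v = integral_density (ebin_density a (ebin_pairing a u v)).
Proof.
move=> fa; apply: integral_density_eq => i y iy.
by rewrite /ebin_density -ebin_pairing_in_chart.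
Qed.

Lemma quarter_ebinE a h k :
  quarter_ebin (pullback_metric a) h k = 4^-1 * integral_density (ebin_density a
    (fun x => \tr (h x *m invmx ((a x)^T *m a x) *m k x *m invmx ((a x)^T *m a x)))).
Proof.
congr (_ * _); apply: integral_density_eq => i y iy.
by rewrite /ebin_density gram_in_chart.
Qed.

Lemma ebin_density_continuous a u v i : full_ranked n M a ->
  {within chart_image i, continuous (ebin_density a (ebin_pairing a u v) i)}.
Proof.
move=> fa; have oV := chart_open i.
apply: (@within_continuous_eq _ _ R^o _ (fun y =>
  \tr (form_in_chart i u y *m invmx ((form_in_chart i a y)^T *m form_in_chart i a y)
    *m (form_in_chart i v y)^T) *
  Num.sqrt (\det ((form_in_chart i a y)^T *m form_in_chart i a y)))).
  by move=> y iy; rewrite /ebin_density -ebin_pairing_in_chart.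
have c (w : one_form M n) y : chart_image i y ->
    form_in_chart i w z @[z --> within (chart_image i) (nbhs y)] --> form_in_chart i w y.
  exact: (subspace_continuousP _ _).1 (smooth_on_continuous (form_smooth w i)) y.
apply/subspace_continuousP => y iy.
have cG : (fun z => (form_in_chart i a z)^T *m form_in_chart i a z)
    @ within (chart_image i) (nbhs y) --> (form_in_chart i a y)^T *m form_in_chart i a y.
  by apply: cvg_mulmx; [apply: cvg_trmx|]; exact: c.
apply: cvgM.
  apply: cvg_mxtrace; apply: cvg_mulmx; last by apply: cvg_trmx; exact: c.
  apply: cvg_mulmx; first exact: c.
  by apply: cvg_invmx; [apply: spd_unit; exact: gram_chart_spd|exact: cG].
exact: (cvg_comp _ _ (cvg_det cG) (@sqrt_continuous R _)).
Qed.

Lemma volume_density_gt0 a i y : full_ranked n M a -> chart_image i y ->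
  0 < Num.sqrt (\det ((form_in_chart i a y)^T *m form_in_chart i a y)).
Proof. by move=> fa iy; rewrite sqrtr_gt0; apply: spd_det_gt0; exact: gram_chart_spd. Qed.

Lemma generalized_ebin_definite a u : full_ranked n M a ->
  generalized_ebin a u u = 0 -> u = 0.
Proof.
move=> fa; rewrite generalized_ebinE// => I0; apply: one_form_eq => x.
have [||i ix] := integral_density_eq0 cM _ _ I0 x.
- by move=> i; exact: ebin_density_continuous.
- move=> i y iy; rewrite mulr_ge0 ?sqrtr_ge0//.
  by apply: trace_spd_quad_ge0; exact: full_rankedP.
rewrite /ebin_density chartK// => /eqP; rewrite mulf_eq0.
rewrite [X in _ || X]gt_eqF ?orbF; last first.
  by apply: volume_density_gt0 => //; exact: chart_image_chart.
by move=> /eqP /(trace_spd_quad_eq0 (full_rankedP x fa)).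
Qed.

Lemma ebin_pairingDr a u v w x :
  ebin_pairing a u (v + w) x = ebin_pairing a u v x + ebin_pairing a u w x.
Proof.
by rewrite /ebin_pairing one_formD [(v x + w x)^T]linearD mulmxDr mxtraceD.
Qed.

Lemma ebin_pairing_vertical a u h (fa : full_ranked n M a) x :
  2 *: sym_product a u = 0 -> ebin_pairing a u (horizontal_lift fa h) x = 0.
Proof.
move=> au; apply: trace_lift_mx_vertical; [exact: full_rankedP|exact: tensor_sym|].
have /(congr1 (fun t : sym_tensor M => t x)) := au.
by rewrite sym_tensorZ sym_productE scalerA mulfV ?scale1r ?pnatr_eq0.
Qed.

Lemma generalized_ebin_vertical a u h (fa : full_ranked n M a) :
  2 *: sym_product a u = 0 -> generalized_ebin a u (horizontal_lift fa h) = 0.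
Proof.
move=> au; rewrite generalized_ebinE// (integral_density_eq (d' := fun _ _ => 0)).
  rewrite /integral_density big1// => p _; rewrite /integral_Rn /Rintegral.
  by under eq_integral do rewrite mulr0; rewrite integral0.
by move=> i y iy; rewrite /ebin_density ebin_pairing_vertical// mul0r.
Qed.

Lemma generalized_ebin_lift a h k (fa : full_ranked n M a) :
  quarter_ebin (pullback_metric a) h k =
  generalized_ebin a (horizontal_lift fa h) (horizontal_lift fa k).
Proof.
have E x : ebin_pairing a (horizontal_lift fa h) (horizontal_lift fa k) x = 4^-1 *
    \tr (h x *m invmx ((a x)^T *m a x) *m k x *m invmx ((a x)^T *m a x)).
  by apply: trace_lift_mx; [exact: full_rankedP|exact: tensor_sym..].
rewrite quarter_ebinE generalized_ebinE//.
rewrite (@integral_density_eq _ _ _ _ (fun i y => 4 * ebin_density a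
  (ebin_pairing a (horizontal_lift fa h) (horizontal_lift fa k)) i y)).
  rewrite integral_densityZ//; first by rewrite mulKf ?pnatr_eq0.
  by move=> i; exact: ebin_density_continuous.
move=> i y iy; rewrite /ebin_density E mulrA; congr (_ * _).
by rewrite mulVKf// pnatr_eq0.
Qed.

(** The vertical part w of v satisfies G(w, v) = G(w, w), pointwise under the
    integral, so that a horizontal v has no vertical part. *)
Lemma horizontalP a v (fa : full_ranked n M a) :
  (forall u, 2 *: sym_product a u = 0 -> generalized_ebin a u v = 0) <->
  v = horizontal_lift fa (2 *: sym_product a v).
Proof.
split=> [hv|-> u u0]; last exact: generalized_ebin_vertical.
set s := horizontal_lift fa _; apply/eqP; rewrite -subr_eq0; apply/eqP.
set w := v - s; have vE : v = w + s by rewrite subrK.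
have aw : 2 *: sym_product a w = 0.
  rewrite /w -scaleN1r sym_productDr sym_productZr scaleN1r scalerBr.
  by rewrite horizontal_liftK subrr.
apply: (generalized_ebin_definite fa).
rewrite -(hv w aw) !generalized_ebinE//; apply: integral_density_eq => i y iy.
rewrite /ebin_density [in RHS]vE ebin_pairingDr.
by rewrite [ebin_pairing a w s _]ebin_pairing_vertical// addr0.
Qed.

End Metrics.

Theorem theorem4p2 (R : realType) (m n : nat) (M : manifold R m) :
  compact [set: M] ->
  orientable M ->
  (m <= n)%N ->
  full_ranked n M !=set0 ->
  riemannian_submersion (full_ranked n M) (metrics M)
    generalized_ebin quarter_ebin pullback_metric.
Proof.
move=> cM _ _ [a0 fa0]; split; first exact: pullback_metric_submersion.
  apply/seteqP; split=> [_ [a fa <-]|g mg]; first exact: pullback_metric_metrics.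
  by have [a fa <-] := pullback_metric_surjective fa0 mg; exists a.
move=> a D fa /pullback_metric_differential_unique -> /=.
have hP v := horizontalP cM v fa.
split.
  split=> [v _ //|v w|h _].
    by rewrite !inE => /hP hv /hP hw vw; rewrite hv hw vw.
  exists (horizontal_lift fa h); last exact: horizontal_liftK.
  by apply/hP; rewrite horizontal_liftK.
move=> v w /hP hv /hP hw; rewrite (generalized_ebin_lift cM _ _ fa).
by rewrite -hv -hw.
Qed.
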